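(* Let $m$ be a Radon measure on $\mathbb{R}_+^n$, let $N$ be a Poisson point process on $\mathbb{R}_+^n$ with intensity measure $m$, let $$\Psi(p)=\inf_{x\in N}\langle p,x\rangle,\qquad p\in\Delta_n,$$ and let $\nu$ be the distribution of the random concave function $\Psi$. Then the tail probability functional of $\nu$ is given by $$\mathsf{T}_\nu(\psi)=\mathbb{P}(\Psi\ge\psi)=\exp\big(-m(\widehat{R}(\psi))\big),\qquad\psi\in\mathcal{C}.$$ In particular, suppose a random vector $C$ in $\mathbb{R}_+^n$ satisfies the asymptotic homogeneity assumption (stated in the context) with exponent $\alpha$ and function $h$, and let $\mu$ be the weak limit on $\mathcal{C}$, as $K\to\infty$, of the distributions of $K^{\frac1{n+\alpha}}\min\{\ell_1,\dots,\ell_K\}$, where $\ell_1,\ell_2,\dots$ are independent copies of $\ell(p)=\langle C,p\rangle$, $p\in\overline{\Delta}_n$. Then $\mu$ is the special case of $\nu$ in which $m$ has density $h$ with respect to Lebesgue measure.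
   Context: Let $n\ge2$, $\mathbb{R}_+^n:=(0,\infty)^n$, $\Delta_n:=\{p\in(0,1)^n:p_1+\cdots+p_n=1\}$, $\overline{\Delta}_n$ its closure, $\langle p,x\rangle=\sum_ip_ix_i$. $\mathcal{C}:=\{\psi:\overline{\Delta}_n\to[0,\infty)\text{ continuous and concave}\}$ carries the (metrizable) topology of uniform convergence on compact subsets of $\Delta_n$ and its Borel $\sigma$-algebra. For a probability measure $\nu$ on $\mathcal{C}$, its tail probability functional is $\mathsf{T}_\nu(\psi)=\nu\{\omega\in\mathcal{C}:\omega\ge\psi\}$. A non-negative concave function on $\Delta_n$ is identified with its unique continuous extension to $\overline{\Delta}_n$; $\Psi\ge\psi$ means $\Psi(p)\ge\psi(p)$ for all $p\in\Delta_n$. Convention: $\inf\emptyset=+\infty$. For $p\in\Delta_n$, $a\ge0$, $R(p,a):=\{x\in\mathbb{R}_+^n:\langle p,x\rangle<a\}$, and $\widehat{R}(\psi):=\bigcup_{p\in\Delta_n}R(p,\psi(p))$. Here $e^{-\infty}=0$. A Poisson point process with intensity measure $m$ is a random closed set $N$ such that for any bounded Borel set $A\subset\mathbb{R}_+^n$ the cardinality $|N\cap A|$ has the Poisson distribution with rate $m(A)$, and $|N\cap A_1|,\dots,|N\cap A_j|$ are independent whenever $A_1,\dots,A_j$ are disjoint. Asymptotic homogeneity assumption: $C=(C_1,\dots,C_n)$ has a joint density $\rho$ on $\mathbb{R}_+^n$, and there exist $\alpha\in\mathbb{R}$ and a non-negative measurable function $h$ on $\mathbb{R}_+^n$ with $\int_{\mathbb{R}_+^n}h(x)\,dx\in(0,\infty]$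 such that $\lim_{\kappa\to0^+}\kappa^{-\alpha}\rho(\kappa x)=h(x)$ for $x\in\mathbb{R}_+^n$, uniformly for $x\in\Delta_n$. Under this assumption $\alpha>-n$ and the weak limit $\mu$ exists. *)

(* Defs.v *)
From HB Require Import structures.
From mathcomp Require Import all_boot all_order all_algebra.
From mathcomp Require Import all_classical all_reals all_analysis.
From mathcomp Require Import measurable_realfun.

Set Implicit Arguments.
Unset Strict Implicit.
Unset Printing Implicit Defensive.

Import Order.TTheory GRing.Theory Num.Theory.
Import numFieldTopology.Exports numFieldNormedType.Exports.

Local Open Scope classical_set_scope.
Local Open Scope ring_scope.

Definition borel (T : ptopologicalType) := g_sigma_algebraType (@open T).

HB.instance Definition _ (T : ptopologicalType) := Measurable.on (borel T).

Section tuple_product.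
Context d (T : measurableType d) (R : realType).
Local Open Scope ereal_scope.

Definition cons_pair k (x : T * k.-tuple T) : k.+1.-tuple T :=
  [tuple of x.1 :: x.2].

Lemma measurable_cons_pair k : measurable_fun setT (@cons_pair k).
Proof.
exact: (measurable_cons (measurable_fst : measurable_fun setT
  (fst : T * k.-tuple T -> T)) measurable_snd).
Qed.

Section step.
Variable mu : {sigma_finite_measure set T -> \bar R}.
Variables (k : nat) (nu : {sigma_finite_measure set (k.-tuple T) -> \bar R}).

Definition tuple_step : set (k.+1.-tuple T) -> \bar R :=
  pushforward (mu \x nu) (@cons_pair k).

HB.instance Definition _ := Measure.copy tuple_step
  (measure_function_pushforward__canonical__measure_function_Measure
    (mu \x nu) (@measurable_cons_pair k)).

Lemma tuple_step_sigma_finite : sigma_finite setT tuple_step.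
Proof.
have [F TF mF] : sigma_finite setT (mu \x nu).
  have /sigma_finiteP[F [TF ndF Foo]] := sigma_finiteT mu.
  have /sigma_finiteP[G [TG ndG Goo]] := sigma_finiteT nu.
  exists (fun i => F i `*` G i).
    rewrite -setXTT TF TG predeqE => -[x y]; split.
      move=> [/= [i _ Fix] [j _ Gjy]]; exists (maxn i j) => //; split.
      - by move: x Fix; exact/subsetPset/ndF/leq_maxl.
      - by move: y Gjy; exact/subsetPset/ndG/leq_maxr.
    by move=> [i _ []/= ? ?]; split; exists i.
  move=> i; have [? ?] := Foo i; have [? ?] := Goo i.
  split; first exact: measurableX.
  by rewrite product_measure1E// lte_mul_pinfty// ge0_fin_numE.
pose u (t : k.+1.-tuple T) := (thead t, [tuple of behead t]).
have mu' : measurable_fun setT u.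
  apply: measurable_fun_pair; last exact: measurable_behead.
  exact: (@measurable_tnth _ T _ ord0).
exists (fun i => u @^-1` (F i)).
  by rewrite -preimage_bigcup -TF preimage_setT.
move=> i; have [mFi Fi] := mF i; split.
  by rewrite -[X in measurable X]setTI; exact: mu'.
rewrite /tuple_step /pushforward (_ : _ @^-1` _ = F i)//.
apply/seteqP; split => -[x t] /=;
  rewrite /u /= (_ : thead (cons_pair (x, t)) = x)//
    (_ : [tuple of _] = t) //; exact/val_inj.
Qed.

HB.instance Definition _ := @Measure_isSigmaFinite.Build _ _ _ tuple_step
  tuple_step_sigma_finite.

End step.

Fixpoint tuple_measure (mu : {sigma_finite_measure set T -> \bar R}) k :
    {sigma_finite_measure set (k.-tuple T) -> \bar R} :=
  match k with
  | 0 => @dirac _ _ [tuple] R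
  | k'.+1 => tuple_step mu (tuple_measure mu k')
  end.

End tuple_product.

Section rV.
Context (R : realType) (n : nat).

Definition row_of_tuple (t : n.-tuple (measurableTypeR R)) : borel 'rV[R]_n :=
  \row_i tnth t i.

Lemma measurable_row_of_tuple : measurable_fun setT row_of_tuple.
Proof.
have := @measurability _ _ _ (borel 'rV[R]_n) setT row_of_tuple (@open 'rV[R]_n).
apply => // _ [U oU <-].
rewrite setTI.
pose B (p : {ffun 'I_n -> rat} * nat) : set 'rV[R]_n :=
  [set v | forall i, `|v ord0 i - ratr (p.1 i)| < p.2.+1%:R^-1].
have -> : row_of_tuple @^-1` U =
    \bigcup_(p in [set p | B p `<=` U]) (row_of_tuple @^-1` B p).
  apply/seteqP; split => [t /= Ut|t [p /= pU Bp]]; last exact: pU.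
  have /nbhs_ballP[e /= e0 eU] : nbhs (row_of_tuple t : 'rV[R]_n) U.
    exact: open_nbhs_nbhs.
  have [k ke] : exists k, 2 * k.+1%:R^-1 < e.
    exists (Num.truncn (2 / e)).
    by rewrite ltr_pdivrMr// mulrC -ltr_pdivrMr// truncnS_gt.
  have /choice[q hq] (i : 'I_n) : exists q,
      `|tnth t i - ratr q| < k.+1%:R^-1.
    have : tnth t i - k.+1%:R^-1 < tnth t i + k.+1%:R^-1.
      by rewrite ltrD2l gtrN// invr_gt0.
    move=> /rat_in_itvoo[q]; rewrite in_itv /= => /andP[q1 q2]; exists q.
    by rewrite distrC ltr_distl q1 q2.
  exists ([ffun i => q i], k) => /=.
    move=> v Bv; apply: eU; split=> // i j; rewrite !ord1.
    rewrite mxE /ball/=; apply: le_lt_trans ke.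
    rewrite (_ : _ - _ = (tnth t j - ratr (q j)) - (v ord0 j - ratr (q j))).
      apply: (le_trans (ler_normB _ _)).
      rewrite mulr_natl mulr2n lerD// ltW//.
      by have := Bv j; rewrite ffunE.
    by rewrite opprB addrA subrK.
  by move=> i; rewrite mxE ffunE.
rewrite bigcup_mkcond; apply: countable_bigcupT_measurable => // p.
case: ifPn => // _.
rewrite (_ : _ @^-1` _ = \bigcap_(i in [set: 'I_n])
   [set t : n.-tuple (measurableTypeR R) |
     `|(tnth t i : R) - ratr (p.1 i)| < p.2.+1%:R^-1]).
  apply: fin_bigcap_measurable => // i _.
  rewrite -[X in measurable X]setTI.
  have mt : measurable_fun setT (fun t : n.-tuple (measurableTypeR R) =>
      `|(tnth t i : R) - ratr (p.1 i)|).
    apply: measurableT_comp => //; apply: measurable_funB => //.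
    exact: (@measurable_tnth _ (measurableTypeR R)).
  exact: (measurable_fun_ltr mt (measurable_cst _)).
by apply/seteqP; split=> t Bt i; have := Bt i; rewrite /= !mxE//; exact.
Qed.

Definition lebesgue_rV : set (borel 'rV[R]_n) -> \bar R :=
  pushforward (tuple_measure (@lebesgue_measure R) n) row_of_tuple.

HB.instance Definition _ := Measure.copy lebesgue_rV
  (measure_function_pushforward__canonical__measure_function_Measure
    (tuple_measure (@lebesgue_measure R) n) measurable_row_of_tuple).

End rV.

Section geometry.
Context (R : realType) (n : nat).
Implicit Types p x : 'rV[R]_n.

Definition dot p x : R := \sum_i p ord0 i * x ord0 i.

Definition orthant : set 'rV[R]_n := [set x | forall i, 0 < x ord0 i].

Definition simplex : set 'rV[R]_n :=
  [set p | (forall i, 0 < p ord0 i < 1) /\ \sum_i p ord0 i = 1].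

Definition region p (a : R) : set 'rV[R]_n :=
  [set x | orthant x /\ dot p x < a].

End geometry.

Notation csimplex R n := (set_type (closure (@simplex R n))).

Section concave_functions.
Context (R : realType) (n : nat).
Local Notation cs := (csimplex R n).

Definition open_simplex : set cs := [set p | simplex (\val p)].

Definition concave (f : cs -> R) := forall (p q r : cs) (t : R),
  0 <= t <= 1 -> \val r = t *: \val p + (1 - t) *: \val q ->
  t * f p + (1 - t) * f q <= f r.

Definition compact_in_simplex : set cs -> Prop :=
  [set K | compact K /\ K `<=` open_simplex].

Definition nonneg_concave : set {family compact_in_simplex, cs -> R} :=
  [set f | [/\ continuous (f : cs -> R), forall p, 0 <= f p & concave f]].

Definition Cspace := set_type nonneg_concave.

HB.instance Definition _ := Topological.on Cspace.

Lemma nonneg_concave0 : nonneg_concave (fun=> 0).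
Proof.
split=> [|//|p q r t _ _]; first exact: cst_continuous.
by rewrite !mulr0 addr0.
Qed.

HB.instance Definition _ :=
  isPointed.Build Cspace (SigSub (mem_set nonneg_concave0)).

Definition cfun (psi : Cspace) : cs -> R := \val psi.

(* [None] stands for the constant function +oo, the infimum over the empty
   set; it is an isolated point, so the Borel sets of [option Cspace] are
   generated by the open sets of [Cspace]. *)
Definition Cbar :=
  g_sigma_algebraType [set Some @` U | U in (@open Cspace)].

HB.instance Definition _ := Measurable.on Cbar.

End concave_functions.

Coercion cfun : Cspace >-> Funclass.

Section tail_functional.
Context (R : realType) (n : nat).

Definition infimum (N : set 'rV[R]_n) (p : 'rV[R]_n) : \bar R :=
  ereal_inf [set (dot p x)%:E | x in N].

(* The continuous extension of [F] from the open to the closed simplex, if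
   there is one in [Cspace]; such an extension is unique. *)
Definition extension (F : 'rV[R]_n -> \bar R) : Cbar R n :=
  xget None [set o | exists2 psi : Cspace R n, o = Some psi &
    forall p, open_simplex p -> F (\val p) = (psi p)%:E].

Definition infimum_ge (N : set 'rV[R]_n) (psi : Cspace R n) : Prop :=
  forall p, open_simplex p -> ((psi p)%:E <= infimum N (\val p))%E.

Definition Psi (N : set 'rV[R]_n) : Cbar R n := extension (infimum N).

Definition Cbar_ge (o : Cbar R n) (psi : Cspace R n) : Prop :=
  if o is Some phi then forall p, open_simplex p -> psi p <= cfun phi p else True.

Definition tail (nu : set (Cbar R n) -> \bar R) (psi : Cspace R n) : \bar R :=
  nu [set o | Cbar_ge o psi].

Definition Rhat (psi : Cspace R n) : set 'rV[R]_n :=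
  \bigcup_(p in @open_simplex R n) region (\val p) (psi p).

End tail_functional.

Section probability_notions.
Context (R : realType).
Local Open Scope ereal_scope.

(* Taking some of the [B i] to be [setT] gives the product rule for every
   subfamily. *)
Definition mutually_independent d d' (Omega : measurableType d)
    (T : measurableType d') (P : probability Omega R) (I : finType)
    (X : I -> Omega -> T) : Prop :=
  forall B : I -> set T, (forall i, measurable (B i)) ->
    P (\bigcap_(i in setT) (X i @^-1` B i)) = \prod_i P (X i @^-1` B i).

Definition independent_copies d1 d2 d' (Omega1 : measurableType d1)
    (Omega2 : measurableType d2) (T : measurableType d')
    (P1 : probability Omega1 R) (X : {mfun Omega1 >-> T})
    (P2 : probability Omega2 R) (Y : nat -> {mfun Omega2 >-> T}) : Prop :=
  (forall K, mutually_independent P2 (fun k : 'I_K => Y k : Omega2 -> T)) /\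
  (forall k B, measurable B -> distribution P2 (Y k) B = distribution P1 X B).

Definition weak_cvg (T : ptopologicalType)
    (mu_ : nat -> set (borel T) -> \bar R) (mu : set (borel T) -> \bar R) :=
  forall f : T -> R, continuous f -> [bounded f x | x in [set: T]] ->
    \int[mu_ k]_x (f x)%:E @[k --> \oo] --> \int[mu]_x (f x)%:E.

(* The Poisson law with infinite rate is the point mass at +oo; it is needed
   because a Radon measure on the open orthant may be infinite on bounded sets
   that approach its boundary. *)
Definition poisson_law d (Omega : measurableType d) (P : probability Omega R)
    (X : Omega -> \bar R) (r : \bar R) : Prop :=
  measurable_fun setT X /\
  match r with
  | r%:E => forall k : nat, P [set w | X w = k%:R%:E] =
              (expR (- r) * r ^+ k / k`!%:R)%:E
  | +oo => P [set w | X w = +oo] = 1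
  | -oo => False
  end.

Section on_orthant.
Variable n : nat.
Local Notation V := (borel 'rV[R]_n).
Local Notation D := (@orthant R n).

(* On the open orthant, inner and outer regularity follow from finiteness on
   compact sets. *)
Definition radon (m : {measure set V -> \bar R}) : Prop :=
  forall K : set 'rV[R]_n, compact K -> K `<=` D -> m K < +oo.

Definition has_density (m : set V -> \bar R) (f : 'rV[R]_n -> R) : Prop :=
  forall A : set V, measurable A -> A `<=` D ->
    m A = \int[@lebesgue_rV R n]_(x in A) (f x)%:E.

Definition random_closed_set d (Omega : measurableType d)
    (N : Omega -> set 'rV[R]_n) : Prop :=
  (forall w, exists2 F, closed F & N w = F `&` D) /\
  (forall K : set 'rV[R]_n, compact K -> K `<=` D ->
    measurable [set w | N w `&` K !=set0]).

Definition count d (Omega : measurableType d) (N : Omega -> set 'rV[R]_n)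
  (A : set 'rV[R]_n) (w : Omega) : \bar R := counting (N w `&` A).

Definition bounded_borel (A : set 'rV[R]_n) : Prop :=
  [/\ measurable (A : set V), bounded_set A & A `<=` D].

Definition poisson_process d (Omega : measurableType d)
    (P : probability Omega R) (m : {measure set V -> \bar R})
    (N : Omega -> set 'rV[R]_n) : Prop :=
  [/\ random_closed_set N,
      forall A, bounded_borel A -> poisson_law P (count N A) (m A) &
      forall j (A : 'I_j -> set 'rV[R]_n),
        (forall i, bounded_borel (A i)) -> trivIset setT A ->
        mutually_independent P (fun i => count N (A i))].

Local Open Scope ring_scope.

Definition asymptotically_homogeneous (rho : 'rV[R]_n -> R) (alpha : R)
    (h : 'rV[R]_n -> R) : Prop :=
  let rho_ (kappa : R) x := kappa `^ (- alpha) * rho (kappa *: x) in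
  [/\ measurable_fun (D : set V) (h : V -> R),
      forall x, D x -> 0 <= h x,
      (0 < \int[@lebesgue_rV R n]_(x in D) (h x)%:E)%E,
      forall x, D x -> rho_ kappa x @[kappa --> 0^'+] --> h x &
      {uniform @simplex R n, rho_ kappa @[kappa --> 0^'+] --> h}].

Definition joint_density (mu : set V -> \bar R) (rho : 'rV[R]_n -> R) : Prop :=
  [/\ measurable_fun (D : set V) (rho : V -> R),
      forall x, D x -> 0 <= rho x & has_density mu rho].

End on_orthant.

End probability_notions.

(* Main.v *)
Require Import Defs.
From HB Require Import structures.
From mathcomp Require Import all_boot all_order all_algebra.
From mathcomp Require Import all_classical all_reals all_analysis.
From mathcomp Require Import measurable_realfun.
From mathcomp Require Import ring lra.

Set Implicit Arguments.
Unset Strict Implicit.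
Unset Printing Implicit Defensive.

Import Order.TTheory GRing.Theory Num.Theory.
Import numFieldTopology.Exports numFieldNormedType.Exports.

Local Open Scope classical_set_scope.
Local Open Scope ring_scope.

(** A finite list s of pairs (p, a), with p interior to the simplex, asks of a
    concave function the inequalities a <= psi p.  For the infimum Psi of the
    functions p |-> <p, x> over the points x of N, they say exactly that N
    misses the union U_s of the half-spaces R(p, a) cut by the orthant.  When N
    is Poisson with intensity m, this void event has probability exp (- m U_s),
    because it says that the Poisson variable counting N in the bounded set U_s
    vanishes.  The law of Psi is thus a [void_law].

    The tail formula holds for every void law ([void_law_tail]): psi <= phi is
    the decreasing limit of its restrictions to finite parts of a countable
    dense set of interior points, and Rhat psi is the increasing union of the
    corresponding U_s.  There is at most one void law for a given m
    ([void_law_unique]), since the cylinder sets are stable under intersection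
    and generate the Borel sets ([sigma_cylinders]).  Both facts rest on one
    inequality, [Cspace_scale]: a nonnegative concave function psi satisfies
    t psi p <= psi q as soon as t p <= q coordinatewise and q is interior.  It
    makes these functions locally equicontinuous, so that pointwise convergence
    on a dense set is the topology of uniform convergence on compact sets.

    It remains to see that the limit mu of rescaled minima is a void law for the
    measure m with density h ([limit_void_law]).  By independence the rescaled
    minimum of K copies satisfies the constraints s with probability
    (1 - P (C in k U_s)) ^ K, where k = K ^ (- 1 / (n + alpha)).  The change of
    variables x = k y and the convergence of k ^ (- alpha) rho (k y) to h y turn
    K P (C in k U_s) into m U_s in the limit ([rescaled_cvg]), whence
    exp (- m U_s).  Homogeneity of h upgrades uniform convergence on the simplex
    to an error at most e (sum_i y_i) ^ alpha on the orthant ([rho_near_h]), a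
    function integrable near the origin because n + alpha > 0 ([exponent_gt0],
    [power_integral_ball]).  Weak convergence then gives mu the right mass on
    closed cylinders: continuous bumps lie between the indicators of the cylinder
    of s and of a cylinder with slightly lower levels, and both mu and
    exp (- m U_s) are continuous as these levels increase back to those of s
    ([limit_above]). *)

(** * Concave functions on the simplex *)

Section simplex_facts.
Context (R : realType) (n : nat).
Implicit Types (p q x : 'rV[R]_n) (u v : csimplex R n).

Lemma dotC p x : dot p x = dot x p.
Proof. by apply: eq_bigr => i _; rewrite mulrC. Qed.

Lemma dotDl p q x : dot (p + q) x = dot p x + dot q x.
Proof. by rewrite -big_split; apply: eq_bigr => i _; rewrite mxE mulrDl. Qed.

Lemma dotZl t p x : dot (t *: p) x = t * dot p x.
Proof. by rewrite mulr_sumr; apply: eq_bigr => i _; rewrite mxE mulrA. Qed.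

Lemma dotZr t p x : dot p (t *: x) = t * dot p x.
Proof. by rewrite mulr_sumr; apply: eq_bigr => i _; rewrite mxE mulrCA. Qed.

Lemma le_dot t p q x : (forall i, t * p ord0 i <= q ord0 i) -> orthant x ->
  t * dot p x <= dot q x.
Proof.
move=> pq x0; rewrite mulr_sumr; apply: ler_sum => i _.
by rewrite mulrA ler_wpM2r// ltW.
Qed.

(** For two or more coordinates, positivity alone forces them below 1. *)
Lemma simplexE p : (2 <= n)%N ->
  (forall i, 0 < p ord0 i) -> \sum_i p ord0 i = 1 -> simplex p.
Proof.
move=> n2 p0 p1; split=> // i; rewrite p0 -p1 (bigD1 i)//= ltrDl.
have [j ji] : exists j : 'I_n, j != i.
  have n0 : (0 < n)%N by exact: leq_trans n2.
  have [i0|i0] := eqVneq i (Ordinal n0).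
    by exists (Ordinal n2); rewrite i0.
  by exists (Ordinal n0); rewrite eq_sym.
rewrite (bigD1 j)//= ltr_pwDl// sumr_ge0// => k _.
exact: ltW.
Qed.

Lemma dot_continuous x : continuous (fun p => dot p x).
Proof.
apply: (@continuous_big _ _ _ _ _ _ _ _ (fun i p => p ord0 i * x ord0 i)).
  exact: add_continuous.
move=> i _ p; have ci := @coord_continuous R 1 n ord0 i p.
exact: continuousM ci (@cst_continuous _ _ (x ord0 i) p).
Qed.

Lemma dot_continuousr p : continuous (dot p).
Proof.
rewrite (_ : dot p = (fun x => dot x p)); first exact: dot_continuous.
by apply/funext => x; exact: dotC.
Qed.

Lemma csimplex_ge0 u i : 0 <= (\val u) ord0 i.
Proof.
have /set_mem cu := valP u.
have : closure [set p : 'rV[R]_n | 0 <= p ord0 i] (\val u).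
  by apply: closure_subset cu => p [/(_ i)/andP[/ltW]].
suff /closure_id <- : closed [set p : 'rV[R]_n | 0 <= p ord0 i] by [].
apply: (@closed_comp _ _ (fun p : 'rV[R]_n => p ord0 i) [set x | 0 <= x]).
  by move=> p _; exact: coord_continuous.
exact: closed_ge.
Qed.

Lemma csimplex_sum u : \sum_i (\val u) ord0 i = 1.
Proof.
have /set_mem cu := valP u.
have sumE p : \sum_i p ord0 i = dot p (const_mx 1).
  by apply: eq_bigr => i _; rewrite mxE mulr1.
have : closure [set p : 'rV[R]_n | dot p (const_mx 1) = 1] (\val u).
  by apply: closure_subset cu => p [_]; rewrite sumE.
suff /closure_id <- : closed [set p : 'rV[R]_n | dot p (const_mx 1) = 1].
  by rewrite sumE.
apply: (@closed_comp _ _ (fun p : 'rV[R]_n => dot p (const_mx 1))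
  [set x | x = 1]).
  by move=> p _; exact: dot_continuous.
exact: closed_eq.
Qed.

Lemma val_continuous : continuous (\val : csimplex R n -> 'rV[R]_n).
Proof. exact: initial_continuous. Qed.

Definition to_csimplex p (sp : simplex p) : csimplex R n :=
  SigSub (mem_set (subset_closure sp)).

End simplex_facts.

Section scale_inequality.
Context (R : realType) (n : nat).
Context (n2 : (2 <= n)%N).
Implicit Types (u v : csimplex R n) (psi : Cspace R n).

Lemma Cspace_ge0 psi u : 0 <= psi u.
Proof. by case: psi => f fP; have [_ f0 _] := set_mem fP; exact: f0. Qed.

Lemma Cspace_concave psi : concave psi.
Proof. by case: psi => f fP; have [_ _ fc] := set_mem fP; exact: fc. Qed.

(** The vector v splits as t u + (1 - t) r with r in the simplex, so concavity
    gives t psi u + (1 - t) psi r <= psi v, and psi r >= 0.  This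
    comparison plays the part of an equicontinuity estimate below. *)
Lemma Cspace_scale psi u v (t : R) : open_simplex v -> 0 <= t ->
  (forall i, t * (\val u) ord0 i <= (\val v) ord0 i) -> t * psi u <= psi v.
Proof.
move=> ov t0 tuv.
have t1 : t <= 1.
  rewrite -(csimplex_sum v) -[leLHS]mulr1 -(csimplex_sum u) mulr_sumr.
  exact: ler_sum.
(* A strictly smaller factor s puts the remainder v - s u, normalised, in the
   open simplex rather than on its boundary. *)
suff H (s : R) : 0 <= s < t -> s * psi u <= psi v.
  have [u0|u0] := eqVneq (psi u) 0; first by rewrite u0 mulr0 Cspace_ge0.
  have pu : 0 < psi u by rewrite lt_def u0 Cspace_ge0.
  rewrite leNgt -ltr_pdivrMr//; apply/negP => vt.
  have [s /andP[vs st]] : exists s, psi v / psi u < s < t.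
    by exists (((psi v / psi u) + t) / 2); rewrite !midf_lt.
  have s0 : 0 <= s by rewrite ltW// (le_lt_trans _ vs)// divr_ge0// Cspace_ge0.
  by move: vs; rewrite ltr_pdivrMr// ltNge H// s0.
case/andP => s0 st.
have s1 : 0 < 1 - s by rewrite subr_gt0 (lt_le_trans st).
pose r := (1 - s)^-1 *: (\val v - s *: \val u).
have sr : simplex r.
  apply: simplexE => // [i|].
    rewrite !mxE mulr_gt0 ?invr_gt0// subr_gt0.
    have [u0|u0] := eqVneq ((\val u) ord0 i) 0.
      by rewrite u0 mulr0; have [/(_ i)/andP[]] := ov.
    apply: lt_le_trans (tuv i); rewrite ltr_pM2r// lt_def u0.
    exact: csimplex_ge0.
  under eq_bigr do rewrite !mxE.
  rewrite -mulr_sumr sumrB -mulr_sumr !csimplex_sum mulr1 mulVf//.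
  by rewrite gt_eqF.
have := @Cspace_concave psi u (to_csimplex sr) v s.
have -> : \val v = s *: \val u + (1 - s) *: \val (to_csimplex sr).
  by rewrite /= /r scalerA mulfV ?gt_eqF// scale1r addrC subrK.
rewrite s0 (ltW (lt_le_trans st t1)) => /(_ isT erefl); apply: le_trans.
by rewrite lerDl mulr_ge0 ?Cspace_ge0// ltW.
Qed.

End scale_inequality.

Section evaluation_on_simplex.
Context (R : realType) (n : nat).

Lemma coord_val_continuous i :
  continuous (fun u : csimplex R n => (\val u) ord0 i).
Proof.
move=> u; exact: (@continuous_comp (csimplex R n) 'rV[R]_n R \val
  (fun p => p ord0 i) u (@val_continuous _ _ u)
  (@coord_continuous _ _ _ _ _ _)).
Qed.

Lemma dot_val_continuous x :
  continuous (fun u : csimplex R n => dot (\val u) x).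
Proof.
move=> u; exact: (@continuous_comp (csimplex R n) 'rV[R]_n R \val
  (fun p => dot p x) u (@val_continuous _ _ u) (@dot_continuous _ _ _ _)).
Qed.

End evaluation_on_simplex.

Section infimum_of_linear.
Context (R : realType) (n : nat).
Implicit Types (u v : csimplex R n) (N : set 'rV[R]_n).

(** The coordinates of u that vanish impose no constraint, so this holds at the
    boundary of the simplex too; it is what makes infima of linear functions
    lower semicontinuous there. *)
Lemma csimplex_near u (e : R) : 0 < e < 1 ->
  nbhs u [set v : csimplex R n |
    forall i, (1 - e) * (\val u) ord0 i <= (\val v) ord0 i].
Proof.
case/andP=> e0 e1; suff H i :
    nbhs u [set v : csimplex R n |
      (1 - e) * (\val u) ord0 i <= (\val v) ord0 i].
  exact: (filter_forall (nbhs_filter u) H).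
have [u0|u0] := eqVneq ((\val u) ord0 i) 0.
  by apply: (@filterE _ (nbhs u)) => v /=; rewrite u0 mulr0 csimplex_ge0.
have ui : (1 - e) * (\val u) ord0 i < (\val u) ord0 i.
  rewrite gtr_pMl; first by rewrite gtrBl.
  by rewrite lt_def u0 csimplex_ge0.
have cu := @coord_val_continuous R n i u.
by apply: filterS (cvgr_gt _ cu _ ui) => v /ltW.
Qed.

Lemma dot_val_ge0 u x : orthant x -> 0 <= dot (\val u) x.
Proof.
by move=> x0; apply: sumr_ge0 => i _; rewrite mulr_ge0 ?csimplex_ge0// ltW.
Qed.

(** An infimum of linear functions is concave and upper semicontinuous.  Lower
    semicontinuity up to the boundary comes from positivity of the points of N:
    if (1 - e) u <= v then (1 - e) <u, x> <= <v, x> for every x in N at once. *)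
Lemma infimum_Cspace N : N !=set0 -> N `<=` @orthant R n ->
  exists psi : Cspace R n, forall u, Defs.infimum N (\val u) = (psi u)%:E.
Proof.
move=> N0 NT; pose E u := [set dot (\val u) x | x in N].
have E0 u : E u !=set0 by case: N0 => x Nx; exists (dot (\val u) x); exists x.
have Elb u : lbound (E u) 0 by move=> _ [x /NT x0 <-]; exact: dot_val_ge0.
have hE u : has_inf (E u) by split=> //; exists 0.
pose f u : R := inf (E u).
have f0 u : 0 <= f u by exact: lb_le_inf.
have fle u x : N x -> f u <= dot (\val u) x.
  by move=> Nx; apply: ge_inf; [exact: (hE u).2|exists x].
have fc : concave f.
  move=> p q r t /andP[t0 t1] rE; apply: lb_le_inf => // _ [x Nx <-].
  rewrite rE dotDl !dotZl lerD// ler_wpM2l ?fle// subr_ge0//.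
have fcont : continuous f.
  move=> u; apply/(@cvgrPdist_lt _ _ _ (nbhs u) (nbhs_filter u)) => e e0.
  have [x Nx xe] : exists2 x, N x & dot (\val u) x < f u + e / 2.
    have e2 : 0 < e / 2 by rewrite divr_gt0.
    by have [_ [x Nx <-] xe] := inf_adherent e2 (hE u); exists x.
  have cx := @dot_val_continuous R n x u.
  (* A relative loss d costs at most d * f u < e. *)
  pose d := Num.min (1 / 2) (e / 2 / (f u + 1)).
  have fu1 : 0 < f u + 1 by rewrite ltr_wpDl.
  have d01 : 0 < d < 1.
    rewrite lt_min divr_gt0//= !divr_gt0//= gt_min; apply/orP; left; lra.
  have du : d * f u < e.
    apply: (@le_lt_trans _ _ (e / 2)); last by rewrite ltr_pdivrMr//; lra.
    have : d <= e / 2 / (f u + 1) by rewrite ge_min lexx orbT.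
    by rewrite ler_pdivlMr// => /(le_trans _); apply; case/andP: d01; nra.
  near=> v; rewrite ltr_distl; apply/andP; split.
    have : f v <= dot (\val v) x by exact: fle.
    have : dot (\val v) x < dot (\val u) x + e / 2.
      near: v; apply: (cvgr_lt _ cx); lra.
    lra.
  suff : (1 - d) * f u <= f v by lra.
  apply: lb_le_inf => // _ [y Ny <-].
  have d1 : 0 <= 1 - d by lra.
  apply: (@le_trans _ _ ((1 - d) * dot (\val u) y)).
    by rewrite ler_wpM2l// fle.
  apply: le_dot; last exact: NT.
  by near: v; exact: csimplex_near.
have fP : @nonneg_concave R n f by split.
exists (SigSub (mem_set fP)) => u.
rewrite /Defs.infimum -image_comp ereal_inf_EFin//; [exact: (hE u).2|exact: E0].
Unshelve. all: by end_near. Qed.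

(** Density is measured by ratios of coordinates, the form in which
    [Cspace_scale] consumes it.  The points are the normalised positive rational
    vectors: rounding u down to v within a factor 1 - e keeps the sum of v
    between 1 - e and 1. *)
Lemma dense_points : (2 <= n)%N -> exists p_ : nat -> csimplex R n,
  (forall k, open_simplex (p_ k)) /\
  forall u, open_simplex u -> forall e : R, 0 < e < 1 -> exists k, forall i,
    (1 - e) * (\val u) ord0 i < (\val (p_ k)) ord0 i /\
    (1 - e) * (\val (p_ k)) ord0 i < (\val u) ord0 i.
Proof.
move=> n2; have n0 : (0 < n)%N by exact: leq_trans n2.
pose w (a : {ffun 'I_n -> rat}) : 'rV[R]_n := \row_i ratr (a i).
pose nw (p : 'rV[R]_n) := (\sum_i p ord0 i)^-1 *: p.
have nwP (v : 'rV[R]_n) : (forall i, 0 < v ord0 i) -> simplex (nw v).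
  move=> v0; have s0 : 0 < \sum_i v ord0 i.
    by rewrite (bigD1 (Ordinal n0))//= ltr_pwDl// sumr_ge0// => i _; exact: ltW.
  apply: simplexE => // [i|]; first by rewrite mxE mulr_gt0// invr_gt0.
  by under eq_bigr do rewrite mxE; rewrite -mulr_sumr mulVf// gt_eqF.
have one_pos (i : 'I_n) : 0 < (const_mx 1 : 'rV[R]_n) ord0 i by rewrite mxE.
pose q (k : nat) : csimplex R n :=
  if unpickle k is Some v then
    if pselect (forall i, 0 < w v ord0 i) is left v0 then to_csimplex (nwP _ v0)
    else to_csimplex (nwP _ one_pos)
  else to_csimplex (nwP _ one_pos).
exists q; split=> [k|u ou e /andP[e0 e1]].
  rewrite /q {q}; case: unpickle => [v|]; last exact: nwP.
  by case: pselect => [v0|_]; exact: nwP.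
have u0 i : 0 < (\val u) ord0 i by have [/(_ i)/andP[]] := ou.
have /choice[v vP] (i : 'I_n) : exists r : rat,
    (1 - e) * (\val u) ord0 i < ratr r < (\val u) ord0 i.
  have : (1 - e) * (\val u) ord0 i < (\val u) ord0 i.
    by rewrite gtr_pMl// gtrBl.
  by move=> /rat_in_itvoo[r]; rewrite in_itv /=; exists r.
pose f := [ffun i => v i].
have wE i : w f ord0 i = ratr (v i) by rewrite mxE ffunE.
have w0 i : 0 < w f ord0 i.
  rewrite wE; have /andP[+ _] := vP i; apply: le_lt_trans.
  by rewrite mulr_ge0// ?ltW// subr_gt0.
exists (pickle f) => i; rewrite /q pickleK; case: pselect => // w0' /=.
rewrite mxE; set s := \sum_j _.
have s0 : 0 < s.
  by rewrite /s (bigD1 i)//= ltr_pwDl// sumr_ge0// => j _; exact: ltW.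
have s1 : s < 1.
  rewrite -(csimplex_sum u); apply: ltr_sum => [|j _].
    by apply/hasP; exists i => //; rewrite mem_index_enum.
  by rewrite wE; have /andP[] := vP j.
have s2 : 1 - e < s.
  rewrite -[1 - e]mulr1 -{2}(csimplex_sum u) mulr_sumr.
  apply: ltr_sum => [|j _].
    by apply/hasP; exists i => //; rewrite mem_index_enum.
  by rewrite wE; have /andP[] := vP j.
have /andP[v1 v2] := vP i; rewrite wE; split.
  rewrite [ltRHS]mulrC ltr_pdivlMr//; apply: lt_trans v1; rewrite gtr_pMr//.
  by rewrite mulr_gt0// subr_gt0.

apply: lt_trans v2; rewrite mulrA -{2}[ratr _]mul1r ltr_pM2r//.
  by rewrite ltr_pdivrMr// mul1r.
by rewrite -wE.
Qed.

End infimum_of_linear.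

Section evaluation_on_functions.
Context (R : realType) (n : nat).
Implicit Types (u v : csimplex R n) (phi psi : Cspace R n).

Lemma eval_continuous u : open_simplex u -> continuous (fun phi => phi u).
Proof.
move=> ou phi.
have Ku : compact_in_simplex [set u].
  by split; [exact: compact_set1|move=> _ ->].
have c1 : {family @compact_in_simplex R n, nbhs (\val phi) --> \val phi} by [].
have /fam_cvgP/(_ _ Ku) := c1.
rewrite uniform_set1 => cu.
apply: (@continuous_comp (Cspace R n) {family @compact_in_simplex R n, _ -> _}
  R \val (fun g => g u)); first exact: initial_continuous.
exact: cu.
Qed.

Definition centroid : 'rV[R]_n := const_mx n%:R^-1.

Lemma simplex_centroid : (2 <= n)%N -> simplex centroid.
Proof.
move=> n2; have n0 : (0 < n)%N by exact: leq_trans n2.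
apply: simplexE => // [i|]; first by rewrite mxE invr_gt0 ltr0n.
under eq_bigr do rewrite mxE.
by rewrite sumr_const card_ord -(mulr_natr n%:R^-1) mulVf// pnatr_eq0 -lt0n.
Qed.

(** The barycentre dominates u / n, hence psi u <= n psi (barycentre). *)
Lemma Cspace_bounded psi : (2 <= n)%N ->
  exists M, 0 <= M /\ forall u, psi u <= M.
Proof.
move=> n2; have n0 : (0 < n)%N by exact: leq_trans n2.
pose c := to_csimplex (simplex_centroid n2).
exists (n%:R * psi c); split; first by rewrite mulr_ge0// Cspace_ge0.
move=> u; rewrite mulrC -ler_pdivrMr ?ltr0n// mulrC.
apply: Cspace_scale => //; first exact: simplex_centroid.
move=> i; rewrite !mxE ler_piMr// -(csimplex_sum u) (bigD1 i)//= lerDl.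
by rewrite sumr_ge0// => j _; exact: csimplex_ge0.
Qed.

Definition near_factor (e : R) u v := forall i,
  (1 - e) * (\val u) ord0 i < (\val v) ord0 i /\
  (1 - e) * (\val v) ord0 i < (\val u) ord0 i.

(** Two functions of the space that agree up to e at v agree up to O(e) at every
    u near v, by comparing each of them at u and v in both directions; the bound
    M on psi turns relative errors into absolute ones. *)
Lemma near_factor_dist (n2 : (2 <= n)%N) phi psi u v (e M : R) :
  open_simplex u -> open_simplex v -> 0 < e <= 1 / 2 -> near_factor e u v ->
  psi u <= M -> `|phi v - psi v| < e ->
  `|phi u - psi u| <= e * (8 * M + 4).
Proof.
move=> ou ov /andP[e0 e2] uv psiM.
have e1 : 0 <= 1 - e by lra.
have H f : (1 - e) * cfun f u <= cfun f v /\ (1 - e) * cfun f v <= cfun f u.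
  by split; apply: Cspace_scale => // i; apply: ltW; have [] := uv i.
rewrite ltr_distl => /andP[d1 d2].
have [a1 a2] := H phi; have [b1 b2] := H psi.
have [phi0 psi0] : 0 <= phi u /\ 0 <= psi u by split; exact: Cspace_ge0.
move: (phi u) (phi v) (psi u) (psi v) => a a' b b'
  in psiM d1 d2 a1 a2 b1 b2 phi0 psi0 *.
have up : (1 - e) * (1 - e) * a <= b + e.
  have : (1 - e) * ((1 - e) * a) <= (1 - e) * (b' + e).
    by rewrite ler_wpM2l// (le_trans a1)// ltW.
  by nra.
have lo : (1 - e) * (1 - e) * b - e <= a.
  have : (1 - e) * ((1 - e) * b - e) <= (1 - e) * a'.
    by rewrite ler_wpM2l//; lra.
  by nra.
rewrite ler_distl; apply/andP; split; first by nra.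
have q : 1 / 4 <= (1 - e) * (1 - e) by nra.
have : (1 - e) * (1 - e) * (a - b) <= e * (2 * M + 1) by nra.
have [ab|ab] := leP a b; first by nra.
have : 1 / 4 * (a - b) <= (1 - e) * (1 - e) * (a - b).
  by rewrite ler_wpM2r// subr_ge0 ltW.
lra.
Qed.

Lemma open_near_factor e v : open [set u | near_factor e u v].
Proof.
rewrite openE => u uv.
suff H i : nbhs u [set w : csimplex R n |
    (1 - e) * (\val w) ord0 i < (\val v) ord0 i /\
    (1 - e) * (\val v) ord0 i < (\val w) ord0 i].
  exact: (filter_forall (nbhs_filter u) H).
have cu := @coord_val_continuous R n i u.
have [u1 u2] := uv i.
have cu' := continuousM (@cst_continuous _ _ (1 - e) u) cu.
have h1 := cvgr_lt _ cu' _ u1.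
have h2 := cvgr_gt _ cu _ u2.
exact: filterI (h1 (nbhs_filter u)) (h2 (nbhs_filter u)).
Qed.

End evaluation_on_functions.

Section pointwise_topology.
Context (R : realType) (n : nat) (n2 : (2 <= n)%N).
Context (p_ : nat -> csimplex R n) (op : forall k, open_simplex (p_ k)).
Context (dp : forall u, open_simplex u -> forall e : R, 0 < e < 1 ->
  exists k, near_factor e u (p_ k)).
Implicit Types (u v : csimplex R n) (phi psi : Cspace R n).

Definition pointwise_nbhd psi k : set (Cspace R n) :=
  [set phi | forall j, (j < k)%N -> `|phi (p_ j) - psi (p_ j)| < k.+1%:R^-1].

Lemma pointwise_nbhd_decr psi k l : (k <= l)%N ->
  pointwise_nbhd psi l `<=` pointwise_nbhd psi k.
Proof.
move=> kl phi h j jk; apply: lt_le_trans (h _ (leq_trans jk kl)) _.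
by rewrite lef_pV2 ?posrE// ler_nat.
Qed.

Lemma pointwise_nbhd_uniform psi (K : set (csimplex R n)) (e : R) :
  compact_in_simplex K -> 0 < e -> exists k, forall phi,
  pointwise_nbhd psi k phi -> forall u, K u -> `|psi u - phi u| < e.
Proof.
move=> [cK oK] e0; have [M [M0 psiM]] := Cspace_bounded psi n2.
have M4 : 0 < 8 * M + 4 by lra.
(* d * (8 * M + 4) is the error in near_factor_dist. *)
pose d := Num.min (1 / 2) (e / 2 / (8 * M + 4)).
have d0 : 0 < d by rewrite lt_min !divr_gt0.
have d2 : d <= 1 / 2 by rewrite ge_min lexx.
have de : d * (8 * M + 4) < e.
  apply: (@le_lt_trans _ _ (e / 2)); last lra.
  by rewrite -ler_pdivlMr// ge_min lexx orbT.
have [m hm] : exists m, forall u, K u ->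
    exists2 k, (k < m)%N & near_factor d u (p_ k).
  have /compact_near_coveringP Kc := cK.
  have [|m _ hm] := Kc nat \oo (fun m u =>
    exists2 k, (k < m)%N & near_factor d u (p_ k)) _.
  - move=> u Ku; have d1 : 0 < d < 1 by lra.
    have [k uk] := dp (oK _ Ku) d1.
    exists ([set w | near_factor d w (p_ k)], [set m | (k < m)%N]) => /=.
      split; last by exists k.+1.
      by apply: open_nbhs_nbhs; split=> //; exact: open_near_factor.
    by move=> [w l] /= [wk kl]; exists k.
  - by exists m => u Ku; exact: (hm m (leqnn m)).
have [l ld] : exists l : nat, l.+1%:R^-1 < d.
  exists (Num.truncn d^-1); rewrite invf_plt ?posrE//.
  exact: truncnS_gt.
exists (maxn m l) => phi h u Ku.
have [k km uk] := hm _ Ku.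
rewrite distrC; apply: le_lt_trans de.
apply: (near_factor_dist n2 _ _ _ uk) => //; [exact: oK|by rewrite d0|].
apply: lt_trans ld; apply: lt_le_trans (h k _) _.
  by rewrite (leq_trans km)// leq_maxl.
by rewrite lef_pV2 ?posrE// ler_nat ltnS leq_maxr.
Qed.

(** The topology of uniform convergence on compact subsets of the open simplex
    is that of pointwise convergence at the points p_k: the filter of pointwise
    neighbourhoods converges to psi uniformly on each compact set. *)
Lemma open_pointwise_nbhd (U : set (Cspace R n)) psi : open U -> U psi ->
  exists k, pointwise_nbhd psi k `<=` U.
Proof.
move=> [W oW WU] Upsi.
pose F : set_system (csimplex R n -> R) :=
  filter_from [set: nat] (fun k =>
    [set (\val phi : _ -> R) | phi in pointwise_nbhd psi k]).
have FF : Filter F.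
  apply: filter_from_filter; first by exists 0%N.
  move=> i j _ _; exists (maxn i j) => // _ [phi h <-].
  split; exists phi => //; apply: pointwise_nbhd_decr h; first exact: leq_maxl.
  exact: leq_maxr.
have : {family @compact_in_simplex R n, F --> (\val psi : _ -> R)}.
  apply/fam_cvgP => K cK; rewrite /cvg_to => P /uniform_nbhs[E [entE EP]].
  have [e /= e0 eE] : exists2 e : R, 0 < e &
      forall x y, `|x - y| < e -> E (x, y).
    move: entE; rewrite -entourage_ballE => -[e /= e0 eE].
    by exists e => // x y xy; exact: eE.
  have [k hk] := pointwise_nbhd_uniform psi cK e0.
  exists k => // _ [phi h <-]; apply: EP => u Ku; exact/eE/hk.
move=> /(_ W); case.
  by apply: open_nbhs_nbhs; split=> //; move: Upsi; rewrite -WU.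
move=> k _ kW; exists k => phi h; rewrite -WU; apply: kW.
by exists phi.
Qed.

End pointwise_topology.

(** * Cylinder sets and void probabilities *)

Section cylinders.
Context (R : realType) (n : nat).
Implicit Types (u v : csimplex R n) (phi psi : Cspace R n) (N : set 'rV[R]_n).
Implicit Types (s : seq (csimplex R n * R)) (o : Cbar R n).
Local Open Scope ereal_scope.

Definition eval_at u o : \bar R :=
  if o is Some phi then (cfun phi u)%:E else +oo.

Definition above s : set (Cbar R n) :=
  [set o | forall a, a \in s -> a.2%:E <= eval_at a.1 o].

(** A set of points misses it exactly when its infimum obeys the inequalities
    of s. *)
Definition void_region s : set 'rV[R]_n :=
  [set x | exists2 a, a \in s & region (\val a.1) a.2 x].

Definition interior_nodes s := forall a, a \in s -> open_simplex a.1.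

Definition cylinders : set (set (Cbar R n)) :=
  [set above s | s in interior_nodes].

(** For empty N both sides are +oo, since no function of the space extends the
    constant +oo and the extension is then None by default. *)
Lemma eval_at_Psi N u : N `<=` @orthant R n -> open_simplex u ->
  eval_at u (Psi N) = Defs.infimum N (\val u).
Proof.
move=> NT ou; have [N0|/set0P N0] := eqVneq N set0.
  rewrite N0 /Defs.infimum image_set0 ereal_inf0 /Psi /extension.
  case: xgetP => //= y _ [psi _ /(_ u ou)].
  by rewrite /Defs.infimum image_set0 ereal_inf0.
have [psi psiE] := infimum_Cspace N0 NT.
rewrite /Psi /extension.
have [|phi -> /(_ u ou) ->//] := @xgetPex _ None [set o : Cbar R n |
  exists2 psi : Cspace R n, o = Some psi &
    forall p, open_simplex p -> Defs.infimum N (\val p) = (psi p)%:E].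
by exists (Some psi); exists psi.
Qed.

Lemma infimum_geP N p (a : R) :
  a%:E <= Defs.infimum N p <-> forall x, N x -> (a <= dot p x)%R.
Proof.
split=> [h x Nx|h].
  rewrite -lee_fin (le_trans h)//; apply: ereal_inf_lbound.
  by exists x.
by apply: le_ereal_inf_tmp => _ [x /h ? <-]; rewrite lee_fin.
Qed.

Lemma above_Psi N s : N `<=` @orthant R n -> interior_nodes s ->
  above s (Psi N) <-> N `&` void_region s = set0.
Proof.
move=> NT os; split=> [h|h a sa].
  rewrite -subset0 => x [Nx [a sa [_ ax]]].
  have := h _ sa; rewrite eval_at_Psi//; last exact: os.
  by move=> /infimum_geP/(_ x Nx); rewrite leNgt ax.
rewrite eval_at_Psi//; last exact: os.
apply/infimum_geP => x Nx; rewrite leNgt; apply/negP => ax.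
suff : (N `&` void_region s) x by rewrite h.
by split=> //; exists a => //; split=> //; exact: NT.
Qed.

Lemma setI_closed_cylinders : setI_closed cylinders.
Proof.
move=> _ _ [s os <-] [t ot <-]; exists (s ++ t) => [a|].
  by rewrite mem_cat => /orP[/os|/ot].
apply/seteqP; split=> [y h|y [hs ht] a].
  by split=> a sa; apply: h; rewrite mem_cat sa ?orbT.
by rewrite mem_cat => /orP[/hs|/ht].
Qed.

Lemma measurable_above s : interior_nodes s -> measurable (above s).
Proof.
move=> os.
have m1 a : a \in s -> measurable [set o : Cbar R n | a.2%:E <= eval_at a.1 o].
  move=> /os oa; rewrite -[X in measurable X]setCK; apply: measurableC.
  apply: sub_sigma_algebra; exists [set phi : Cspace R n | phi a.1 < a.2]%R.
    rewrite openE => phi phia.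
    have := cvgr_lt _ (@eval_continuous R n _ oa phi) _ phia.
    by apply; exact: nbhs_filter.
  apply/seteqP; split=> [_ [phi /= h <-]/=|[phi|] /=].
  - by rewrite lee_fin leNgt h.
  - by rewrite lee_fin => /negP; rewrite -ltNge => h; exists phi.
  - by rewrite leey.
rewrite (_ : above s =
    \bigcap_(a in [set` s]) [set o | a.2%:E <= eval_at a.1 o]).
  apply: fin_bigcap_measurable => // a; exact: m1.
by [].
Qed.

Definition cylinder_space := g_sigma_algebraType cylinders.

Lemma measurable_eval_at u : open_simplex u ->
  measurable_fun setT (eval_at u : cylinder_space -> \bar R).
Proof.
move=> ou; apply: (measurability _ (ErealGenCInfty.measurableE R)).
move=> _ [_ [r ->] <-]; apply: sub_sigma_algebra; exists [:: (u, r)].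
  by move=> a; rewrite inE => /eqP ->.
rewrite setTI; apply/seteqP; split=> [y h|y /= h a].
  by rewrite /= in_itv /= andbT; exact: (h (u, r) (mem_head _ _)).
by rewrite inE => /eqP -> /=; move: h; rewrite in_itv /= andbT.
Qed.

(** An open set of functions is a union of pointwise neighbourhoods, and those
    with rational centres suffice; each is cut out by finitely many inequalities
    between values at the p_k. *)
Lemma sigma_cylinders (n2 : (2 <= n)%N) (B : set (Cbar R n)) :
  measurable B -> <<s cylinders >> B.
Proof.
apply: smallest_sub; first exact: smallest_sigma_algebra.
move=> _ [U oU <-].
have [p_ [op dp]] := dense_points R n2.
pose d (k : nat) : R := (2 * k.+1%:R)^-1%R.
pose Bk (kr : nat * seq rat) : set (Cspace R n) := [set phi | forall j,
  (j < kr.1)%N -> (`|phi (p_ j) - ratr (nth 0 kr.2 j)| < d kr.1)%R].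
have UE : U = \bigcup_(kr in [set kr | Bk kr `<=` U]) Bk kr.
  apply/seteqP; split=> [psi Upsi|phi [kr /= + hphi]]; last exact.
  have [k kU] := open_pointwise_nbhd n2 op dp oU Upsi.
  have dk : (0 < d k)%R by rewrite invr_gt0 mulr_gt0.
  have /choice[r rP] (j : nat) :
      exists r : rat, (`|cfun psi (p_ j) - ratr r| < d k)%R.
    have : (cfun psi (p_ j) - d k < cfun psi (p_ j) + d k)%R.
      by rewrite ltrD2l gtrN.
    move=> /rat_in_itvoo[q]; rewrite in_itv /= => /andP[q1 q2]; exists q.
    by rewrite distrC ltr_distl q1 q2.
  exists (k, mkseq r k) => [/= phi h|j /= jk]; last by rewrite nth_mkseq.
  apply: kU => j jk; have := h j jk; rewrite /= nth_mkseq// => hj.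
  rewrite (_ : k.+1%:R^-1 = d k + d k)%R; last first.
    have : (k.+1%:R != 0 :> R)%R by rewrite pnatr_eq0.
    by rewrite /d; move: (k.+1%:R : R)%R => y y0; field.
  rewrite (_ : _ - _ = (cfun phi (p_ j) - ratr (r j)) -
    (cfun psi (p_ j) - ratr (r j)))%R.
    by rewrite (le_lt_trans (ler_normB _ _))// ltrD.
  by rewrite opprB addrA subrK.
have mBk kr : measurable ([set Some phi | phi in Bk kr] : set cylinder_space).
  pose Y (j : nat) : set cylinder_space := [set o |
    (ratr (nth 0 kr.2 j) - d kr.1)%:E < eval_at (p_ j) o] `&`
    [set o | eval_at (p_ j) o < (ratr (nth 0 kr.2 j) + d kr.1)%:E].
  have mY j : measurable (Y j).
    apply: measurableI.
      rewrite -[X in measurable X]setTI.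
      exact: (measurable_fun_lte (measurable_cst _) (measurable_eval_at (op j))).
    rewrite -[X in measurable X]setTI.
    exact: (measurable_fun_lte (measurable_eval_at (op j)) (measurable_cst _)).
  pose f : set cylinder_space := [set o | eval_at (p_ 0%N) o < +oo].
  have mf : measurable f.
    rewrite -[X in measurable X]setTI.
    exact: (measurable_fun_lte (measurable_eval_at (op _)) (measurable_cst _)).
  rewrite (_ : [set _ | _ in _] = f `&` \bigcap_(j in `I_kr.1) Y j).
    by apply: measurableI => //; apply: bigcap_measurableType.
  apply/seteqP; split=> [_ [phi h <-]|[phi|] [fo ho]]; last by [].
    split=> [|j jk]; first by rewrite /f /= ltry.
    have := h j jk; rewrite ltr_distl => /andP[? ?].
    by split; rewrite /= lte_fin.
  exists phi => // j jk; have [/= + +] := ho j jk.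
  by rewrite !lte_fin ltr_distl => -> ->.
rewrite UE image_bigcup bigcup_mkcond.
apply: (@countable_bigcupT_measurable _ cylinder_space) => // kr.
by case: ifPn => // _; exact: mBk.
Qed.

End cylinders.

Section void_probabilities.
Context (R : realType) (n : nat).
Implicit Types (u v : csimplex R n) (phi psi : Cspace R n) (N : set 'rV[R]_n).
Implicit Types (s : seq (csimplex R n * R)) (o : Cbar R n).
Local Notation V := (borel 'rV[R]_n).
Local Open Scope ereal_scope.

(** Named after the void probabilities of a point process of intensity m: the
    constraints of s hold when the process has no point in the region of s. *)
Definition void_law (Q : set (Cbar R n) -> \bar R) (m : set V -> \bar R) :=
  forall s, interior_nodes s -> Q (above s) = expeR (- m (void_region s)).

Lemma open_orthant : open (@orthant R n).
Proof.
rewrite openE => x x0.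
suff H i : nbhs x [set y : 'rV[R]_n | (0 < y ord0 i)%R].
  exact: (filter_forall (nbhs_filter x) H).
have := cvgr_gt _ (@coord_continuous R 1 n ord0 i x) _ (x0 i).
by apply; exact: nbhs_filter.
Qed.

Lemma open_region p (a : R) : open (region p a : set 'rV[R]_n).
Proof.
apply: openI; first exact: open_orthant.
apply: (@open_comp _ _ (dot p) [set r | (r < a)%R]); last exact: open_lt.
by move=> x _; exact: dot_continuousr.
Qed.

Lemma open_measurable_borel (T : ptopologicalType) (U : set T) :
  open U -> measurable (U : set (borel T)).
Proof. exact: sub_sigma_algebra. Qed.

Lemma void_region_bigcup s :
  void_region s = \bigcup_(a in [set` s]) region (\val a.1) a.2.
Proof. by []. Qed.

Lemma measurable_void_region s : measurable (void_region s : set V).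
Proof.
apply: open_measurable_borel; rewrite void_region_bigcup.
apply: bigcup_open => a _.
exact: open_region.
Qed.

Lemma void_region_orthant s : void_region s `<=` @orthant R n.
Proof. by move=> x [a _ []]. Qed.

Lemma void_region_bounded s : interior_nodes s ->
  exists2 S : R, (0 < S)%R &
    forall x, void_region s x -> (\sum_i x ord0 i < S)%R.
Proof.
move=> os.
exists (\sum_(a <- s) \sum_i `|a.2 / (\val a.1) ord0 i| + 1)%R.
  by rewrite ltr_wpDl// sumr_ge0// => a _; exact: sumr_ge0.
move=> x [a sa [x0 xa]]; rewrite (big_rem a)//= -addrA ltr_pwDr//.
  by rewrite ltr_wpDl// sumr_ge0// => b _; exact: sumr_ge0.
apply: ler_sum => i _; apply: le_trans (ler_norm _).
have a0 : (0 < (\val a.1) ord0 i)%R by have [/(_ i)/andP[]] := os _ sa.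
rewrite ler_pdivlMr// mulrC; apply: le_trans (ltW xa).
rewrite /dot (bigD1 i)//= lerDl sumr_ge0// => j _.
by rewrite mulr_ge0 ?csimplex_ge0// ltW.
Qed.

Lemma bounded_borel_void_region s :
  interior_nodes s -> bounded_borel (void_region s).
Proof.
move=> os; split; [exact: measurable_void_region| |exact: void_region_orthant].
have [S S0 hS] := void_region_bounded os.
exists S; split; first exact: num_real.
move=> t St x sx; rewrite /Num.norm /= mx_normrE; apply/bigmax_leP; split.
  by rewrite ltW// (lt_trans S0).
move=> /= [i j] _ /=; rewrite (ord1 i).
have x0 := void_region_orthant sx; rewrite gtr0_norm//.
apply: ltW; apply: lt_trans St; apply: le_lt_trans (hS x sx).
by rewrite (bigD1 j)//= lerDl sumr_ge0// => k _; rewrite ltW.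
Qed.

(** The two factors come from comparing first at a dense point, then back. *)
Lemma scale_limit (a b : R) : (0 <= a)%R ->
  (forall e : R, (0 < e < 1)%R -> ((1 - e) * ((1 - e) * b) <= a)%R) ->
  (b <= a)%R.
Proof.
move=> a0 h; rewrite leNgt; apply/negP => ab.
have b0 : (0 < b)%R by exact: le_lt_trans ab.
have e01 : (0 < (b - a) / (4 * b) < 1)%R.
  rewrite divr_gt0 ?subr_gt0 ?mulr_gt0//=.
  by rewrite ltr_pdivrMr ?mulr_gt0// mul1r; lra.
have := h _ e01; move/andP: e01 => [e0 e1].
have eb : ((b - a) / (4 * b) * b = (b - a) / 4)%R.
  by field; rewrite gt_eqF.
set e := (_ / _)%R in e0 e1 eb *.
nra.
Qed.

Lemma expeRN_lty (x : \bar R) : 0 <= x -> expeR (- x) < +oo.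
Proof.
move=> x0; apply: (@le_lt_trans _ _ 1); last exact: ltry.
by rewrite -expeR0 lee_expeR oppe_le0.
Qed.

(** Continuity from below of m, transported through the decreasing bijection
    x |-> exp (- x) of [0, +oo]; infinite values of m are allowed. *)
Lemma le_expeRN (m : {measure set V -> \bar R}) (L : \bar R) (B : (set V)^nat) :
  0 <= L -> (forall k, measurable (B k)) -> nondecreasing_seq B ->
  (forall k, L <= expeR (- m (B k))) -> L <= expeR (- m (\bigcup_k B k)).
Proof.
move=> L0 mB ndB LB; have [y yL] := expeR_total L0.
rewrite -yL lee_expeR leeNr.
have cB := nondecreasing_cvg_mu mB (bigcupT_measurable _ mB) ndB.
apply: cvge_le (cB _ m).
by apply: nearW => k /=; rewrite leeNr -lee_expeR yL.
Qed.

(** Restricting psi <= phi to the first k dense points gives a decreasing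
    sequence of cylinders, and the regions of these increase to Rhat psi. *)
Lemma void_law_tail (n2 : (2 <= n)%N) (Q : {measure set (Cbar R n) -> \bar R})
    (m : {measure set V -> \bar R}) psi :
  void_law Q m -> tail Q psi = expeR (- m (Rhat psi)).
Proof.
move=> Qm; have [p_ [op dp]] := dense_points R n2.
pose s k := [seq (p_ j, psi (p_ j)) | j <- iota 0 k].
have os k : interior_nodes (s k) by move=> _ /mapP[j _ ->]; exact: op.
have sk k j : (j < k)%N -> (p_ j, psi (p_ j)) \in s k.
  by move=> jk; apply/mapP; exists j => //; rewrite mem_iota.
have sS k l : (k <= l)%N -> {subset s k <= s l}.
  move=> kl _ /mapP[j + ->]; rewrite mem_iota => /andP[_ jk].
  by apply: sk; exact: leq_trans kl.
have tailE : [set o | Cbar_ge o psi] = \bigcap_k above (s k).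
  apply/seteqP; split=> [[phi|] h k _ _ /mapP[j _ ->]|[phi|] h] //=.
  - by rewrite lee_fin; exact: h.
  - by rewrite leey.
  move=> u ou; apply: scale_limit => [|e e01]; first exact: Cspace_ge0.
  have [k uk] := dp u ou e e01.
  have e1 : (0 <= 1 - e)%R by case/andP: e01 => _ /ltW; rewrite subr_ge0.
  have h1 : ((1 - e) * psi u <= psi (p_ k))%R.
    by apply: Cspace_scale => // i; apply: ltW; have [] := uk i.
  have h2 : ((1 - e) * cfun phi (p_ k) <= cfun phi u)%R.
    by apply: Cspace_scale => // i; apply: ltW; have [] := uk i.
  have := h k.+1 I _ (sk k.+1 k (ltnSn k)); rewrite /= lee_fin => h3.
  by apply: le_trans h2; rewrite ler_wpM2l// (le_trans h1).
have RhatE : Rhat psi = \bigcup_k void_region (s k).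
  apply/seteqP; split=> [x [u ou [x0 xu]]|x [k _ [a]]]; last first.
    by move=> /mapP[j _ ->] xj; exists (p_ j); first exact: op.
  apply: contrapT => nx; move: xu; apply/negP; rewrite -leNgt.
  apply: scale_limit => [|e e01]; first exact: dot_val_ge0.
  have [k uk] := dp u ou e e01.
  have e1 : (0 <= 1 - e)%R by case/andP: e01 => _ /ltW; rewrite subr_ge0.
  have h1 : ((1 - e) * psi u <= psi (p_ k))%R.
    by apply: Cspace_scale => // i; apply: ltW; have [] := uk i.
  have h2 : ((1 - e) * dot (\val (p_ k)) x <= dot (\val u) x)%R.
    by apply: le_dot => // i; apply: ltW; have [] := uk i.
  apply: le_trans h2; rewrite ler_wpM2l// (le_trans h1)//.
  rewrite leNgt; apply/negP => xk; apply: nx; exists k.+1 => //.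
  by exists (p_ k, psi (p_ k)) => //; exact: sk.
have mA k : measurable (above (s k)) by exact: measurable_above.
have mB k : measurable (void_region (s k) : set V).
  exact: measurable_void_region.
have ndB : nondecreasing_seq (fun k => void_region (s k)).
  by move=> k l kl; apply/subsetPset => x [a /(sS _ _ kl) la ax]; exists a.
have niA : nonincreasing_seq (fun k => above (s k)).
  by move=> k l kl; apply/subsetPset => o h a /(sS _ _ kl); exact: h.
have mI := bigcapT_measurable mA.
rewrite /tail tailE RhatE; apply/eqP; rewrite eq_le; apply/andP; split.
  apply: le_expeRN => // k; rewrite -Qm//; apply: le_measure; rewrite ?inE//.
  exact: bigcap_inf.
have A0 : Q (above (s 0%N)) < +oo.
  by rewrite Qm// expeRN_lty.
apply: cvge_ge (nonincreasing_cvg_mu A0 mA mI niA).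
apply: nearW => k /=; rewrite Qm// lee_expeR leeN2.
apply: le_measure; rewrite ?inE//; first exact: bigcupT_measurable.
by move=> x skx; exists k.
Qed.

Lemma void_law_unique (n2 : (2 <= n)%N)
    (Q1 Q2 : {measure set (Cbar R n) -> \bar R})
    (m : {measure set V -> \bar R}) B :
  void_law Q1 m -> void_law Q2 m -> measurable B -> Q1 B = Q2 B.
Proof.
move=> Q1m Q2m /(sigma_cylinders n2).
have T : cylinders [set: Cbar R n].
  by exists [::] => //; apply/seteqP; split=> // o _ a.
apply: (g_sigma_algebra_measure_unique (@cylinders R n) _ (fun=> setT)) => //.
- by move=> _ [s os <-]; exact: measurable_above.
- by rewrite bigcup_const.
- exact: setI_closed_cylinders.
- by move=> _ [s os <-]; rewrite Q1m// Q2m.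
- move=> _; rewrite (_ : setT = above [::]); last first.
    by apply/seteqP; split=> // o _ a.
  by rewrite Q1m// expeRN_lty.
Qed.

End void_probabilities.

(** * Infima over Poisson processes *)

Section image_measure.
Context d1 d2 (T1 : measurableType d1) (T2 : measurableType d2) (R : realType).
Context (mu : {measure set T1 -> \bar R}) (f : T1 -> T2).
Context (mf : measurable_fun setT f).

Definition image_measure : {measure set T2 -> \bar R} :=
  measure_function_pushforward__canonical__measure_function_Measure mu mf.

Lemma image_measureE A : image_measure A = mu (f @^-1` A).
Proof. by []. Qed.

End image_measure.

Section poisson.
Context (R : realType) (n : nat) (n2 : (2 <= n)%N).
Context d (Omega : measurableType d) (P : probability Omega R).
Local Notation V := (borel 'rV[R]_n).
Context (m : {measure set V -> \bar R}) (N : Omega -> set 'rV[R]_n).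
Local Open Scope ereal_scope.

Lemma counting_eq0 (A : set 'rV[R]_n) :
  (counting A : \bar R) = 0 <-> A = set0.
Proof.
rewrite /counting; case: asboolP => [fA|fA]; split=> //.
- move=> -[] /eqP; rewrite pnatr_eq0 => /eqP/finmap.cardfs0_eq A0.
  by rewrite -(fset_setK fA) A0 set_fset0.
- by move=> ->; rewrite fset_set0 finmap.cardfs0.
- by move=> A0; case: fA; rewrite A0; exact: finite_set0.
Qed.

(** In the infinite-rate case the variable is almost surely +oo and both sides
    vanish. *)
Lemma poisson_law0 (X : Omega -> \bar R) (r : \bar R) :
  poisson_law P X r -> measurable [set w | X w = 0] /\
  P [set w | X w = 0] = expeR (- r).
Proof.
move=> [mX Xr]; have m1 (y : \bar R) : measurable [set w | X w = y].
  by rewrite -[X in measurable X]setTI; exact: (mX measurableT [set y]).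
split; first exact: m1.
case: r Xr => [r|Xy|//]; first by move=> /(_ 0%N) ->; rewrite mulr1 divr1.
apply/eqP; rewrite eq_le measure_ge0 andbT.
apply: (@le_trans _ _ (P (~` [set w | X w = +oo]))).
  apply: le_measure; rewrite ?inE//; first exact: measurableC.
  by move=> w /= ->.
by rewrite probability_setC// Xy subee.
Qed.

Context (PN : poisson_process P m N).

Lemma poisson_orthant w : N w `<=` @orthant R n.
Proof.
by have [[h _] _ _] := PN; have [F _ ->] := h w => x [].
Qed.

Lemma preimage_Psi_above s : interior_nodes s ->
  (fun w : Omega => Psi (N w)) @^-1` above s =
  [set w : Omega | Defs.count N (void_region s) w = 0].
Proof.
move=> os; apply/seteqP; split=> w /=.
  by move=> /(above_Psi (@poisson_orthant w) os) h; apply/counting_eq0.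
by move=> /counting_eq0 h; apply/(above_Psi (@poisson_orthant w) os).
Qed.

(** The region of s is bounded even though Rhat psi need not be, hence the law
    of the count in it is Poisson. *)
Lemma poisson_above s : interior_nodes s ->
  measurable ((fun w : Omega => Psi (N w)) @^-1` above s) /\
  P ((fun w : Omega => Psi (N w)) @^-1` above s) = expeR (- m (void_region s)).
Proof.
move=> os; rewrite preimage_Psi_above//; apply: poisson_law0.
by have [_ + _] := PN; apply; exact: bounded_borel_void_region.
Qed.

Lemma measurable_Psi : measurable_fun setT (fun w : Omega => Psi (N w)).
Proof.
apply: (measurability (@cylinders R n)).
  apply/seteqP; split=> B; first exact: sigma_cylinders.
  apply: smallest_sub; first exact: sigma_algebra_measurable.
  by move=> _ [s os <-]; exact: measurable_above.
move=> _ [_ [s os <-] <-]; rewrite setTI.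
by have [] := poisson_above os.
Qed.

Lemma poisson_void_law :
  void_law (pushforward P (fun w : Omega => Psi (N w))) m.
Proof. by move=> s os; have [] := poisson_above os. Qed.

Lemma infimum_ge_Psi psi :
  [set w : Omega | infimum_ge (N w) psi] =
  (fun w : Omega => Psi (N w)) @^-1` [set o | Cbar_ge o psi].
Proof.
have H w u : open_simplex u ->
    eval_at u (Psi (N w)) = Defs.infimum (N w) (\val u).
  by move=> ou; rewrite eval_at_Psi//; exact: poisson_orthant.
apply/seteqP; split=> w /= h.
  case E : (Psi (N w)) => [phi|//] /= u ou.
  by rewrite -lee_fin; have := h u ou; rewrite -H// E.
move=> u ou; rewrite -H//; case: (Psi (N w)) h => [phi|] /= h.
  by rewrite lee_fin; exact: h.
by rewrite leey.
Qed.

Lemma poisson_tail psi :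
  P [set w : Omega | infimum_ge (N w) psi] = expeR (- m (Rhat psi)).
Proof.
rewrite infimum_ge_Psi.
exact: (void_law_tail n2 (Q := image_measure P measurable_Psi) psi
  poisson_void_law).
Qed.

End poisson.

(** * Lebesgue measure under dilations *)

Section lebesgue_scaling.
Context (R : realType).
Local Notation T := (measurableTypeR R).
Local Notation leb := (@lebesgue_measure R).
Context (c : R) (c0 : 0 < c).
Local Open Scope ereal_scope.

Lemma measurable_scale : measurable_fun setT (fun x : T => c * x : T)%R.
Proof. exact: mulrl_measurable. Qed.

Lemma lebesgue_measure_scale (A : set T) : measurable A ->
  leb A = c%:E * leb ((fun x : T => c * x : T)%R @^-1` A).
Proof.
pose mu := mscale (NngNum (ltW c0)) (image_measure leb measurable_scale).
move=> mA; rewrite (@lebesgue_measure_unique R mu)// => _ [[a b] _ <-] /=.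
rewrite /mu /mscale image_measureE /=.
rewrite (_ : _ @^-1` _ = `]a / c, b / c]%classic)%R; last first.
  apply/seteqP; split=> x /=; rewrite !in_itv/=.
    by rewrite ltr_pdivrMr// ler_pdivlMr// mulrC.
  by rewrite ltr_pdivrMr// ler_pdivlMr// mulrC.
rewrite [LHS]lebesgue_measure_itv [X in _ = _ * X]lebesgue_measure_itv /=.
rewrite !lte_fin ltr_pM2r ?invr_gt0//.
case: ifPn => ab; last by rewrite mule0.
by rewrite -!EFinB -EFinM -mulrBl mulrCA mulfV ?mulr1// gt_eqF.
Qed.

Definition tuple_scale k (t : k.-tuple T) : k.-tuple T :=
  [tuple (c * tnth t i : R)%R | i < k].

Lemma measurable_tuple_scale k : measurable_fun setT (@tuple_scale k).
Proof.
apply/measurable_fun_tnthP => i.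
rewrite (_ : _ \o _ =
    (fun x : T => c * x : T)%R \o (fun t : k.-tuple T => tnth t i)).
  apply: measurableT_comp; first exact: measurable_scale.
  exact: measurable_tnth.
by apply/funext => t /=; rewrite tnth_mktuple.
Qed.

(** By induction on k: the image under the dilation of a product measure is
    determined by its values on rectangles. *)
Lemma tuple_measure_scale k (A : set (k.-tuple T)) : measurable A ->
  tuple_measure leb k A =
  (c ^+ k)%:E * tuple_measure leb k (@tuple_scale k @^-1` A).
Proof.
elim: k A => [|k IH] A mA.
  rewrite expr0 mul1e /= /dirac !indicE.
  rewrite (_ : _ @^-1` A = A)//; apply/funext => t; rewrite /preimage/=.
  by congr (A _); rewrite [LHS]tuple0 [RHS]tuple0.
pose g (x : T * k.-tuple T) := ((c * x.1)%R : T, tuple_scale x.2).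
have mg : measurable_fun setT g.
  apply: measurable_fun_pair.
    by apply: measurableT_comp; [exact: measurable_scale|exact: measurable_fst].
  apply: measurableT_comp; first exact: measurable_tuple_scale.
  exact: measurable_snd.
have ck : (0 <= c ^+ k.+1)%R by rewrite exprn_ge0// ltW.
pose m' := mscale (NngNum ck) (image_measure (leb \x tuple_measure leb k) mg).
have mA' : measurable (@cons_pair _ T k @^-1` A).
  by rewrite -[X in measurable X]setTI; exact: measurable_cons_pair.
rewrite /= /tuple_step /pushforward (@product_measure_unique _ _ _ _ _ _ _ m')//.
  transitivity ((c ^+ k.+1)%:E * (leb \x tuple_measure leb k)
    (g @^-1` (@cons_pair _ T k @^-1` A))); first by [].
  congr (_ * (_ \x _) _).
  apply/funext => -[x t]; rewrite /preimage /=; congr (A _).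
  apply: eq_from_tnth => i; rewrite tnth_mktuple.
  case: (unliftP ord0 i) => [j ->|->]; last by rewrite /cons_pair /= !tnth0.
  by rewrite /cons_pair /= !tnthS tnth_mktuple.
move=> B D mB mD; transitivity ((c ^+ k.+1)%:E * (leb \x tuple_measure leb k)
  (g @^-1` (B `*` D))); first by [].
rewrite (_ : g @^-1` _ = ((fun x : T => c * x : T)%R @^-1` B) `*`
  (@tuple_scale k @^-1` D))//.
have mB' : measurable ((fun x : T => c * x : T)%R @^-1` B).
  by rewrite -[X in measurable X]setTI; exact: measurable_scale.
have mD' : measurable (@tuple_scale k @^-1` D).
  by rewrite -[X in measurable X]setTI; exact: measurable_tuple_scale.
rewrite product_measure1E// exprS EFinM muleACA; congr (_ * _); apply/esym.
  exact: lebesgue_measure_scale.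
exact: IH.
Qed.

End lebesgue_scaling.

Section lebesgue_row_vectors.
Context (R : realType).
Local Notation T := (measurableTypeR R).
Local Notation leb := (@lebesgue_measure R).
Local Open Scope ereal_scope.

Lemma continuous_measurable_borel (U1 U2 : ptopologicalType) (f : U1 -> U2) :
  continuous f -> measurable_fun setT (f : borel U1 -> borel U2).
Proof.
move=> cf; apply: (@measurability _ _ _ (borel U2) _ _ (@open U2)) => //.
move=> _ [U oU <-]; rewrite setTI; apply: sub_sigma_algebra.
by apply: open_comp => // x _; exact: cf.
Qed.

Lemma continuous_measurable_real (U : ptopologicalType) (f : U -> R) :
  continuous f -> measurable_fun setT (f : borel U -> R).
Proof.
move=> cf; apply: (measurability _ (RGenOpens.measurableE R)).
move=> _ [_ [a [b ->]] <-]; rewrite setTI; apply: sub_sigma_algebra.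
by apply: open_comp => [x _|]; [exact: cf|exact: interval_open].
Qed.

Lemma lebesgue_rV_scale n (c : R) (A : set (borel 'rV[R]_n)) : (0 < c)%R ->
  measurable A -> lebesgue_rV A =
  (c ^+ n)%:E * lebesgue_rV ((fun x : 'rV[R]_n => c *: x) @^-1` A).
Proof.
move=> c0 mA; rewrite /lebesgue_rV /pushforward (tuple_measure_scale c0).
  congr (_ * tuple_measure _ _ _); apply/funext => t; rewrite /preimage/=.
  congr (A _); apply/matrixP => i j; rewrite !mxE tnth_mktuple.
  by [].
by rewrite -[X in measurable X]setTI; exact: measurable_row_of_tuple.
Qed.

Lemma lebesgue_rV_box n (S : R) :
  @lebesgue_rV R n [set x | forall i, (0 <= x ord0 i <= S)%R] < +oo.
Proof.
rewrite /lebesgue_rV /pushforward.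
rewrite (_ : _ @^-1` _ = [set t | forall i, (0 <= tnth t i <= S)%R]);
  last first.
  by apply/seteqP; split=> t /= h i; have := h i; rewrite mxE.
elim: n => [|n IH].
  by rewrite /= /dirac indicE ltry.
rewrite /= /tuple_step /pushforward.
rewrite (_ : _ @^-1` _ = `[0%R, S]%classic `*`
    [set t | forall i, (0 <= tnth t i <= S)%R]); last first.
  apply/seteqP; split=> -[x t] /=; rewrite in_itv /=.
    move=> h; split; first exact: (h ord0).
    by move=> i; have := h (lift ord0 i); rewrite /cons_pair tnthS.
  move=> [xS h] i; case: (unliftP ord0 i) => [j ->|->]; rewrite /cons_pair.
    by rewrite tnthS.
  by rewrite tnth0.
rewrite product_measure1E//.
  rewrite lte_mul_pinfty// ?measure_ge0//.
    have h : leb [set` `[0%R, S]] < +oo.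
      by rewrite lebesgue_measure_itv /= lte_fin; case: ifP => _; rewrite ltry.
    by rewrite ge0_fin_numE ?measure_ge0//; exact: h.
rewrite (_ : [set _ | _] = \bigcap_(i in [set: 'I_n])
   ((fun t : n.-tuple T => tnth t i) @^-1` `[0%R, S]%classic)).
  apply: fin_bigcap_measurable => // i _.
  rewrite -[X in measurable X]setTI; apply: measurable_tnth => //.
by apply/seteqP; split=> t /= h i; have := h i; rewrite /= in_itv//=; exact.
Qed.

End lebesgue_row_vectors.

Section scaling_of_integrals.
Context (R : realType) (n : nat).
Local Notation V := (borel 'rV[R]_n).
Local Notation D := (@orthant R n).
Local Notation leb := (@lebesgue_rV R n).
Implicit Types (x : 'rV[R]_n) (A : set V).

(** The set k A, written as a preimage to make its measurability immediate. *)
Definition dilate (k : R) A : set V := [set x | A (k^-1 *: x)].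

Lemma orthant_scale k x : 0 < k -> D x -> D (k *: x).
Proof. by move=> k0 x0 i; rewrite mxE mulr_gt0. Qed.

Lemma measurable_scale_rV (k : R) :
  measurable_fun setT (fun x : V => k *: x : V).
Proof. by apply: continuous_measurable_borel; exact: scaler_continuous. Qed.

Lemma measurable_preimage_scale (k : R) A : measurable A ->
  measurable ((fun x : V => k *: x : V) @^-1` A).
Proof.
by move=> mA; rewrite -[X in measurable X]setTI; exact: measurable_scale_rV.
Qed.

Lemma measurable_dilate k A : measurable A -> measurable (dilate k A).
Proof. exact: measurable_preimage_scale. Qed.

Lemma dilateK k A : 0 < k -> (fun x : V => k *: x : V) @^-1` dilate k A = A.
Proof.
move=> k0; apply/seteqP; split=> x;
by rewrite /dilate /preimage/= scalerA mulVf ?scale1r// gt_eqF.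
Qed.

Lemma dilate_orthant k A : 0 < k -> A `<=` D -> dilate k A `<=` D.
Proof.
move=> k0 AD x /AD/(orthant_scale k0).
by rewrite scalerA mulfV ?scale1r// gt_eqF.
Qed.

Lemma measurable_orthant : measurable (D : set V).
Proof. by apply: open_measurable_borel; exact: open_orthant. Qed.

Lemma measurable_fun_scale (k : R) A (f : V -> R) : 0 < k -> A `<=` D ->
  measurable_fun (D : set V) f -> measurable A ->
  measurable_fun A (fun x : V => f (k *: x)).
Proof.
move=> k0 AD mf mA.
apply: (@measurable_comp _ _ _ _ _ _ (D : set V) f A
  (fun x : V => k *: x : V)) => //.
- exact: measurable_orthant.
- by move=> _ [x /AD Dx <-]; exact: orthant_scale.
- by apply: measurable_funTS; exact: measurable_scale_rV.
Qed.

Local Open Scope ereal_scope.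

Lemma integral_scale (k : R) A (f : V -> \bar R) : (0 < k)%R -> measurable A ->
  measurable_fun A f -> (forall x, A x -> 0 <= f x) ->
  \int[leb]_(x in A) f x =
  (k ^+ n)%:E *
  \int[leb]_(x in (fun x : V => (k *: x)%R : V) @^-1` A) f (k *: x)%R.
Proof.
move=> k0 mA mf f0; have kn : (0 <= k ^+ n)%R by rewrite exprn_ge0// ltW.
pose mu := mscale (NngNum kn) (image_measure leb (measurable_scale_rV k)).
rewrite (@eq_measure_integral _ _ _ _ mu); last first.
  by move=> B mB _; exact: lebesgue_rV_scale.
rewrite ge0_integral_mscale//; congr (_ * _).
rewrite (@ge0_integral_pushforward _ _ _ _ _ _ (measurable_scale_rV k))//.
by move=> x /set_mem; exact: f0.
Qed.

End scaling_of_integrals.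

Section total_mass.
Context (R : realType) (n : nat).
Local Notation V := (borel 'rV[R]_n).
Local Notation D := (@orthant R n).
Local Notation leb := (@lebesgue_rV R n).
Implicit Types (x : 'rV[R]_n) (A : set V).

Definition total x : R := \sum_i x ord0 i.

Lemma totalZ k x : total (k *: x) = k * total x.
Proof. by rewrite mulr_sumr; apply: eq_bigr => i _; rewrite mxE. Qed.

Lemma total_continuous : continuous total.
Proof.
rewrite (_ : total = dot (const_mx 1)); first exact: dot_continuousr.
by apply/funext => x; apply: eq_bigr => i _; rewrite mxE mul1r.
Qed.

Lemma total_gt0 x : (2 <= n)%N -> D x -> 0 < total x.
Proof.
move=> n2 x0; rewrite /total (bigD1 (Ordinal (ltnW n2)))//= ltr_pwDl//.
by rewrite sumr_ge0// => i _; exact: ltW.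
Qed.

Lemma le_total x i : D x -> x ord0 i <= total x.
Proof.
by move=> x0; rewrite /total (bigD1 i)//= lerDl sumr_ge0// => j _; exact: ltW.
Qed.

Definition annulus (a b : R) : set V := [set x | D x /\ a <= total x < b].

Lemma annulus_orthant a b : annulus a b `<=` D.
Proof. by move=> x []. Qed.

Lemma measurable_annulus a b : measurable (annulus a b).
Proof.
rewrite (_ : annulus a b =
    (D : set V) `&` (total : V -> R) @^-1` `[a, b[%classic).
  apply: measurableI; first exact: measurable_orthant.
  rewrite -[X in measurable X]setTI.
  exact: (continuous_measurable_real total_continuous).
by apply/seteqP; split=> x; rewrite /annulus/= in_itv.
Qed.

Lemma dilate_annulus k a b : 0 < k ->
  dilate k (annulus a b) = annulus (k * a) (k * b).
Proof.
move=> k0; have kV : 0 < k^-1 by rewrite invr_gt0.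
apply/seteqP; split=> x [x0 xab]; split.
- rewrite -(scale1r x) -(mulfV (lt0r_neq0 k0)) -scalerA.
  exact: orthant_scale.
- by move: xab; rewrite totalZ mulrC ler_pdivlMr// ltr_pdivrMr// ![_ * k]mulrC.
- exact: orthant_scale.
- by rewrite totalZ mulrC ler_pdivlMr// ltr_pdivrMr// ![_ * k]mulrC.
Qed.

Lemma lebesgue_annulus a b : (2 <= n)%N -> (leb (annulus a b) < +oo)%E.
Proof.
move=> n2; apply: le_lt_trans (@lebesgue_rV_box R n b).
have mbox :
    measurable ([set x : 'rV[R]_n | forall i, 0 <= x ord0 i <= b] : set V).
  have -> : [set x : 'rV[R]_n | forall i, 0 <= x ord0 i <= b] =
      \bigcap_(i in [set: 'I_n]) ((fun x : V => x ord0 i) @^-1` `[0, b]%classic).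
    by apply/seteqP; split=> x /= h i; have := h i; rewrite /= in_itv/=; exact.
  apply: fin_bigcap_measurable => // i _.
  rewrite -[X in measurable X]setTI.
  apply: (@continuous_measurable_real R 'rV[R]_n (fun x => x ord0 i)) => //.
  exact: coord_continuous.
apply: le_measure; rewrite ?inE//; first exact: measurable_annulus.
move=> x [x0 /andP[_ xb]] i; rewrite ltW//= (le_trans (le_total i x0))//.
  exact: ltW.
Qed.

Local Open Scope ereal_scope.
Context (alpha : R).

Definition power_integral A := \int[leb]_(x in A) (total x `^ alpha)%:E.

Lemma power_integral_ge0 A : 0 <= power_integral A.
Proof. by apply: integral_ge0 => x _; rewrite lee_fin powR_ge0. Qed.

Lemma measurable_power A : measurable_fun A (fun x : V => total x `^ alpha)%R.
Proof.
apply: measurable_funTS; apply: (measurableT_comp (measurable_powR _)).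
exact: continuous_measurable_real total_continuous.
Qed.

Lemma power_integral_annulus a b : (2 <= n)%N -> (0 < a)%R ->
  power_integral (annulus a b) < +oo.
Proof.
(* The power is monotone, so it is bounded by its value at a or at b, according
   to the sign of alpha. *)
move=> n2 a0; pose M := (a `^ alpha + b `^ alpha)%R.
apply: (@le_lt_trans _ _ (\int[leb]_(x in annulus a b) (cst M%:E) x)).
  apply: ge0_le_integral => //.
  - exact: measurable_annulus.
  - by move=> x _; rewrite lee_fin powR_ge0.
  - by apply/measurable_EFinP; exact: measurable_power.
  - move=> x [x0 /andP[ax xb]]; rewrite lee_fin /M.
    have t0 : (0 < total x)%R by exact: lt_le_trans ax.
    have [al|al] := leP 0%R alpha.
      rewrite (@le_trans _ _ (b `^ alpha)%R)//; last by rewrite lerDr powR_ge0.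
      by rewrite ge0_ler_powR// ?nnegrE ?ltW// (lt_trans t0).
    rewrite (@le_trans _ _ (a `^ alpha)%R)//; last by rewrite lerDl powR_ge0.
    rewrite -[alpha]opprK !(powRN _ (- alpha)) lef_pV2 ?posrE ?powR_gt0//.
    by rewrite ge0_ler_powR// ?nnegrE ?oppr_ge0 ?ltW.
rewrite integral_cst; last exact: measurable_annulus.
rewrite lte_mul_pinfty// ?lee_fin ?addr_ge0 ?powR_ge0//.
exact: lebesgue_annulus.
Qed.

(** The integrand is homogeneous of degree alpha and Lebesgue measure of degree
    n. *)
Lemma power_integral_half A : measurable A -> A `<=` D ->
  power_integral ((fun x : V => (2 *: x)%R : V) @^-1` A) =
  ((2^-1) `^ (n%:R + alpha))%:E * power_integral A.
Proof.
move=> mA AD; have h0 : (0 < 2^-1 :> R)%R by rewrite invr_gt0.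
have mA' : measurable ((fun x : V => (2 *: x)%R : V) @^-1` A).
  exact: measurable_preimage_scale.
rewrite /power_integral (integral_scale h0)//; last 2 first.
- by apply/measurable_EFinP; exact: measurable_power.
- by move=> x _; rewrite lee_fin powR_ge0.
have -> : (fun x : V => (2^-1 *: x)%R : V) @^-1`
    ((fun x : V => (2 *: x)%R : V) @^-1` A) = A.
  by apply/seteqP; split=> x; rewrite /preimage/= scalerA mulfV// scale1r.
rewrite (eq_integral
    (fun x : V => ((2^-1) `^ alpha)%:E * (total x `^ alpha)%:E)).
  rewrite ge0_integralZl//.
  - rewrite muleA -EFinM -powR_mulrn ?ltW// -powRD//.
    by rewrite invr_eq0 pnatr_eq0 implybT.
  - by apply/measurable_EFinP; exact: measurable_power.
  - by move=> x _; rewrite lee_fin powR_ge0.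
move=> x /set_mem/AD x0; rewrite -EFinM totalZ powRM//.
by apply: sumr_ge0 => i _; exact: ltW.
Qed.

End total_mass.

Section power_integral_near_zero.
Context (R : realType) (n : nat) (n2 : (2 <= n)%N) (alpha : R).
Context (na : 0 < n%:R + alpha).
Local Notation V := (borel 'rV[R]_n).
Local Notation D := (@orthant R n).
Local Notation leb := (@lebesgue_rV R n).
Local Open Scope ereal_scope.

(** The annuli F_j = [S 2^-j, S) satisfy F_(j+1) = F_1 U (1/2) F_j, so their
    integrals obey I_(j+1) = c + q I_j with q = 2^-(n + alpha) < 1, and stay
    below the fixed point c / (1 - q). *)
Lemma power_integral_ball (S : R) : (0 < S)%R ->
  power_integral alpha (@annulus R n 0 S) < +oo.
Proof.
move=> S0; pose F j := @annulus R n (S * 2^-1 ^+ j)%R S.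
have mg (A : set V) : measurable_fun A (fun x : V => (total x `^ alpha)%:E).
  by apply/measurable_EFinP; exact: measurable_power.
have g0 (x : V) : 0 <= (total x `^ alpha)%:E by rewrite lee_fin powR_ge0.
have F1 : power_integral alpha (F 1%N) < +oo.
  by apply: power_integral_annulus => //; rewrite mulr_gt0.
pose c := fine (power_integral alpha (F 1%N)).
have cE : c%:E = power_integral alpha (F 1%N).
  by rewrite fineK// ge0_fin_numE// power_integral_ge0.
pose q := (2^-1 `^ (n%:R + alpha))%R.
have q1 : (q < 1)%R.
  have h1 : (2^-1 < 1 :> R)%R by rewrite invf_lt1// ltr1n.
  have := @gt0_ltr_powR R _ na 2^-1%R 1%R; rewrite !nnegrE powR1; apply=> //.
have twoK (x : 'rV[R]_n) : x = (2^-1 *: (2 *: x))%R.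
  by rewrite scalerA mulVf ?scale1r.
have FE j : power_integral alpha (F j) <= (c / (1 - q))%:E.
  elim: j => [|j IH].
    rewrite /F expr0 mulr1 (_ : annulus S S = set0).
      rewrite /power_integral integral_set0 lee_fin divr_ge0//.
        by rewrite fine_ge0// power_integral_ge0.
      by rewrite subr_ge0 ltW.
    by rewrite -subset0 => x [_ /andP[/le_lt_trans/[apply]]]; rewrite ltxx.
  have FU : F j.+1 = F 1%N `|` (fun x : V => (2 *: x)%R : V) @^-1` F j.
    apply/seteqP; split=> x.
      move=> [x0 /andP[ax xb]]; have [xS|xS] := leP (S * 2^-1)%R (total x).
        by left; split=> //; rewrite expr1 xS.
      right; split; first exact: orthant_scale.
      rewrite totalZ -ler_pdivrMl// -ltr_pdivlMl// (mulrC 2^-1%R S) xS andbT.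
      by rewrite mulrCA -exprS.
    move=> [[x0 /andP[ax xb]]|[x0 /andP[]]].
      split=> //; rewrite xb andbT (le_trans _ ax)// ler_pM2l// exprS expr1.
      by rewrite ler_piMr// exprn_ile1// invf_le1// ler1n.
    rewrite totalZ -ler_pdivrMl// -ltr_pdivlMl// mulrCA -exprS => ax xb.
    split.
      by rewrite (twoK x); apply: orthant_scale.
    by rewrite ax (lt_trans xb)// gtr_pMl// invf_lt1// ltr1n.
  have mG : measurable ((fun x : V => (2 *: x)%R : V) @^-1` F j).
    by apply: measurable_preimage_scale; exact: measurable_annulus.
  have -> : power_integral alpha (F j.+1) = power_integral alpha (F 1%N) +
      power_integral alpha ((fun x : V => (2 *: x)%R : V) @^-1` F j).
    rewrite FU; apply: ge0_integral_setU => //; first exact: measurable_annulus.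
    apply/disj_setPS => x [[_ /andP[ax _]] [_ /andP[_]]].
    by rewrite totalZ -ltr_pdivlMl// mulrC ltNge -(expr1 2^-1%R) ax.
  rewrite power_integral_half -?cE; last 2 first.
  - exact: measurable_annulus.
  - exact: annulus_orthant.
  apply: (@le_trans _ _ (c%:E + q%:E * (c / (1 - q))%:E)).
    by rewrite leeD2l// lee_wpmul2l// lee_fin powR_ge0.
  rewrite -EFinM -EFinD lee_fin le_eqVlt; apply/orP; left; apply/eqP.
  by field; rewrite subr_eq0 gt_eqF.
have UF : annulus 0 S = \bigcup_j F j.
  apply/seteqP; split=> x; last first.
    move=> [j _ [x0 /andP[ax xS]]]; split=> //.
    by rewrite xS andbT ltW// total_gt0.
  move=> [x0 /andP[_ xS]]; have t0 := total_gt0 n2 x0.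
  have : (S * 2^-1 ^+ j)%R @[j --> \oo] --> (S * 0)%R.
    by apply: cvgMr; apply: cvg_expr; rewrite ger0_norm// invf_lt1// ltr1n.
  rewrite mulr0 => /cvgr_lt/(_ _ t0)[j _ /(_ j (leqnn j)) /= h].
  by exists j => //; split=> //; rewrite xS ltW.
have ndF : nondecreasing_seq F.
  move=> i j ij; apply/subsetPset => x [x0 /andP[ax xS]]; split=> //.
  rewrite xS andbT (le_trans _ ax)// ler_pM2l//.
  by rewrite ler_wiXn2l// invf_le1// ler1n.
apply: (@le_lt_trans _ _ (c / (1 - q))%:E); last exact: ltry.
rewrite UF.
have mF j : measurable (F j) by exact: measurable_annulus.
have := @ge0_nondecreasing_set_cvg_integral _ _ _ F
  (fun x : V => (total x `^ alpha)%:E) leb ndF mF (fun j => mg (F j))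
  (fun j x _ => g0 x).
by apply: cvge_le; apply: nearW => j; exact: FE.
Qed.

End power_integral_near_zero.

(** * Densities that are asymptotically homogeneous at the origin *)

Section homogeneous_density.
Context (R : realType) (n : nat) (n2 : (2 <= n)%N).
Local Notation V := (borel 'rV[R]_n).
Local Notation D := (@orthant R n).
Local Notation leb := (@lebesgue_rV R n).
Context (muC : probability V R) (rho h : 'rV[R]_n -> R) (alpha : R).
Context (jd : joint_density muC rho).
Context (ah : asymptotically_homogeneous rho alpha h).
Implicit Types (x : 'rV[R]_n) (A : set V).

Lemma at_right0P (P : R -> Prop) : (\forall k \near 0^'+, P k) <->
  exists2 d : R, 0 < d & forall k, 0 < k < d -> P k.
Proof.
rewrite near_withinE; split=> [/nbhs_ballP[d /= d0 H]|[d d0 H]].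
  exists d => // k /andP[k0 kd]; apply: H => //.
  by rewrite /ball/= sub0r normrN gtr0_norm.
apply/nbhs_ballP; exists d => // k; rewrite /ball/= sub0r normrN => kd k0.
by apply: H; rewrite k0 (le_lt_trans (ler_norm _)).
Qed.

Lemma rho_uniform (e : R) : 0 < e -> exists2 k0, 0 < k0 & forall k x,
  0 < k < k0 -> simplex x -> `|k `^ (- alpha) * rho (k *: x) - h x| < e.
Proof.
move=> e0; have [_ _ _ _ U] := ah.
pose E := [set f : 'rV[R]_n -> R | forall x, simplex x -> `|h x - f x| < e].
have nE : nbhs (h : {uniform` @simplex R n -> R}) E.
  apply/uniform_nbhs; exists [set xy | `|xy.1 - xy.2| < e]; split.
    by rewrite -entourage_ballE; exists e.
  by move=> f hf x; exact: hf.
have /at_right0P[d d0 dP] := U E nE.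
by exists d => // k x kd sx; rewrite distrC; exact: dP.
Qed.

(** Both sides are limits of k ^ (- alpha) rho (k c x), along k and along
    k c. *)
Lemma h_homogeneous (c : R) x : 0 < c -> D x -> h (c *: x) = c `^ alpha * h x.
Proof.
move=> c0 x0; have [_ _ _ lim _] := ah.
have cx0 := orthant_scale c0 x0.
have ca : 0 < c `^ alpha by rewrite powR_gt0.
apply/eqP; rewrite -subr_eq0 -normr_le0; apply/ler_addgt0Pr => e e0.
rewrite add0r.
have e2 : 0 < e / 2 by rewrite divr_gt0.
have e3 : 0 < e / 2 / c `^ alpha by rewrite divr_gt0.
have /cvgrPdist_lt/(_ _ e2)/at_right0P[d1 d10 H1] := lim _ cx0.
have /cvgrPdist_lt/(_ _ e3)/at_right0P[d2 d20 H2] := lim _ x0.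
(* k and k c must both be close to 0. *)
pose k := Num.min d1 (d2 / c) / 2.
have m0 : 0 < Num.min d1 (d2 / c) by rewrite lt_min d10 divr_gt0.
have k0 : 0 < k by rewrite divr_gt0.
have km : k < Num.min d1 (d2 / c) by rewrite ltr_pdivrMr// ltr_pMr// ltr1n.
have kd1 : 0 < k < d1 by rewrite k0 (lt_le_trans km)// ge_min lexx.
have kd2 : 0 < k * c < d2.
  by rewrite mulr_gt0//= -ltr_pdivlMr// (lt_le_trans km)// ge_min lexx orbT.
have h1 := H1 _ kd1; have h2 := H2 _ kd2.
have E : k `^ (- alpha) * rho (k *: (c *: x)) =
    c `^ alpha * ((k * c) `^ (- alpha) * rho ((k * c) *: x)).
  rewrite scalerA mulrA; congr (_ * _).
  rewrite (powRM _ (ltW k0) (ltW c0)) mulrCA -powRD; last first.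
    by rewrite (gt_eqF c0) implybT.
  by rewrite subrr powRr0 mulr1.
have h3 : `|c `^ alpha * h x - k `^ (- alpha) * rho (k *: (c *: x))| <= e / 2.
  rewrite E -mulrBr normrM gtr0_norm// mulrC -ler_pdivlMr//.
  exact: ltW.
rewrite (_ : _ - _ = (h (c *: x) - k `^ (- alpha) * rho (k *: (c *: x))) -
  (c `^ alpha * h x - k `^ (- alpha) * rho (k *: (c *: x)))); last by lra.
by rewrite (le_trans (ler_normB _ _))// (splitr e) lerD// ltW.
Qed.

(** Write x as its total mass times a point of the simplex and apply the uniform
    estimate there; homogeneity of h produces the weight. *)
Lemma rho_near_h (e : R) : 0 < e -> exists2 k0, 0 < k0 & forall k x,
  0 < k -> D x -> k * total x < k0 ->
  `|k `^ (- alpha) * rho (k *: x) - h x| <= e * total x `^ alpha.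
Proof.
move=> e0; have [k0 k00 H] := rho_uniform e0; exists k0 => // k x kpos Dx kx.
have t0 := total_gt0 n2 Dx; have tV : 0 < (total x)^-1 by rewrite invr_gt0.
pose y := (total x)^-1 *: x.
have Dy : D y by exact: orthant_scale.
have sy : simplex y.
  by apply: simplexE => //; rewrite -/(total y) totalZ mulVf// gt_eqF.
have xy : x = total x *: y by rewrite scalerA mulfV ?scale1r// gt_eqF.
have kt : 0 < k * total x < k0 by rewrite mulr_gt0.
have E1 : h x = total x `^ alpha * h y by rewrite {1}xy h_homogeneous.
have E3 : k *: x = (k * total x) *: y by rewrite -scalerA -xy.
have E2 : k `^ (- alpha) * rho (k *: x) =
    total x `^ alpha * ((k * total x) `^ (- alpha) * rho ((k * total x) *: y)).
  rewrite E3 mulrA (powRM _ (ltW kpos) (ltW t0)); congr (_ * _).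
  rewrite mulrCA -powRD; last by rewrite (gt_eqF t0) implybT.
  by rewrite subrr powRr0 mulr1.
rewrite E1 E2 -mulrBr normrM gtr0_norm ?powR_gt0// mulrC ler_pM2r ?powR_gt0//.
by apply: ltW; exact: H.
Qed.

Local Open Scope ereal_scope.

Lemma measurable_h A : A `<=` D -> measurable A ->
  measurable_fun A (fun x : V => (h x)%:E).
Proof.
move=> AD mA; apply/measurable_EFinP; have [mh _ _ _ _] := ah.
apply: (measurable_funS (@measurable_orthant R n) AD); exact: mh.
Qed.

Lemma h_ge0 A x : A `<=` D -> A x -> 0 <= (h x)%:E.
Proof. by move=> AD /AD Dx; rewrite lee_fin; have [_ + _ _ _] := ah; exact. Qed.

(** Change of variables y = k x in the law of C. *)
Lemma integral_rescaled (k : R) A : (0 < k)%R -> measurable A -> A `<=` D ->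
  \int[leb]_(x in A) (k `^ (- alpha) * rho (k *: x))%:E =
  (k `^ (- (n%:R + alpha)))%:E * muC (dilate k A).
Proof.
move=> k0 mA AD; have [mrho rho0 dens] := jd.
have kA := measurable_dilate k mA; have kAD := dilate_orthant k0 AD.
have mrho' : measurable_fun (dilate k A) (rho : V -> R).
  exact: (measurable_funS (@measurable_orthant R n) kAD mrho).
rewrite dens// [in RHS](integral_scale k0)//; last 2 first.
- exact/measurable_EFinP.
- by move=> x /kAD Dx; rewrite lee_fin rho0.
rewrite dilateK// muleA -EFinM -powR_mulrn ?ltW// -powRD; last first.
  by rewrite (gt_eqF k0) implybT.
have -> : (- (n%:R + alpha) + n%:R = - alpha :> R)%R.
  by rewrite opprD addrAC addNr add0r.
rewrite -ge0_integralZl//.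
- by apply/measurable_EFinP; exact: measurable_fun_scale.
- by move=> x /AD Dx; rewrite lee_fin rho0//; exact: orthant_scale.
- by rewrite lee_fin powR_ge0.
Qed.

(** Integrates the pointwise error bound in both directions.  Infinite integrals
    are allowed: the first inequality is what will show them finite. *)
Lemma muC_compare (e : R) : (0 < e)%R -> exists2 k0 : R, (0 < k0)%R &
  forall k S A, (0 < k)%R -> (k * S < k0)%R -> measurable A ->
    A `<=` annulus 0 S ->
    \int[leb]_(x in A) (h x)%:E <=
      (k `^ (- (n%:R + alpha)))%:E * muC (dilate k A) +
      e%:E * power_integral alpha A /\
    (k `^ (- (n%:R + alpha)))%:E * muC (dilate k A) <=
      \int[leb]_(x in A) (h x)%:E + e%:E * power_integral alpha A.
Proof.
move=> e0; have [k0 k00 H] := rho_near_h e0.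
exists k0 => // k S A kpos kS mA AS.
have AD : A `<=` D by move=> x /AS[].
have [mrho rho0 _] := jd.
have mr : measurable_fun A (fun x : V => (k `^ (- alpha) * rho (k *: x))%:E).
  apply/measurable_EFinP; apply: measurable_funM => //.
  exact: measurable_fun_scale.
have r0 (x : V) : A x -> 0 <= (k `^ (- alpha) * rho (k *: x))%:E.
  move=> /AD Dx; rewrite lee_fin mulr_ge0 ?powR_ge0// rho0//.
  exact: orthant_scale.
have mg : measurable_fun A (fun x : V => (total x `^ alpha)%:E).
  by apply/measurable_EFinP; exact: measurable_power.
have g0 (x : V) : 0 <= (total x `^ alpha)%:E by rewrite lee_fin powR_ge0.
have meg : measurable_fun A (fun x : V => e%:E * (total x `^ alpha)%:E).
  exact: measurable_funeM.
have eg0 (x : V) : 0 <= e%:E * (total x `^ alpha)%:E.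
  by rewrite mule_ge0// lee_fin ltW.
have near (x : V) : A x ->
    (`|k `^ (- alpha) * rho (k *: x) - h x| <= e * total x `^ alpha)%R.
  move=> Ax; apply: H => //; first exact: AD.
  apply: lt_trans kS; rewrite ltr_pM2l//.
  by have [_ /andP[]] := AS _ Ax.
have pE : e%:E * power_integral alpha A =
    \int[leb]_(x in A) (e%:E * (total x `^ alpha)%:E).
  by rewrite ge0_integralZl// lee_fin ltW.
have mhA := measurable_h AD mA.
have h0 (x : V) : A x -> 0 <= (h x)%:E by exact: h_ge0.
rewrite -integral_rescaled// pE -!ge0_integralD//; split.
  apply: ge0_le_integral => //.
  - exact: emeasurable_funD.
  - move=> x Ax; rewrite -EFinM -EFinD lee_fin; have := near x Ax.
    by rewrite ler_distl => /andP[]; lra.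
apply: ge0_le_integral => //.
- exact: emeasurable_funD.
- move=> x Ax; rewrite -EFinM -EFinD lee_fin; have := near x Ax.
  by rewrite ler_distl => /andP[]; lra.
Qed.

End homogeneous_density.

Section rescaled_convergence.
Context (R : realType) (n : nat) (n2 : (2 <= n)%N).
Local Notation V := (borel 'rV[R]_n).
Local Notation D := (@orthant R n).
Local Notation leb := (@lebesgue_rV R n).
Context (muC : probability V R) (rho h : 'rV[R]_n -> R) (alpha : R).
Context (jd : joint_density muC rho).
Context (ah : asymptotically_homogeneous rho alpha h).
Implicit Types (x : 'rV[R]_n) (A : set V).
Local Open Scope ereal_scope.

(** If n + alpha <= 0, then k ^ (- (n + alpha)) <= 1 for k <= 1, so the integral
    of h is bounded by the probability that C lies in k A, up to e.  That
    probability tends to 0 with k because the sets k A shrink to nothing. *)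
Lemma integral_annulus_le0 (a b : R) : (0 < a)%R -> (0 < b)%R ->
  (n%:R + alpha <= 0)%R -> \int[leb]_(x in annulus a b) (h x)%:E <= 0.
Proof.
move=> a0 b0 na; apply/lee_addgt0Pr => e e0; rewrite add0e.
have Joo := power_integral_annulus alpha b n2 a0.
pose J := fine (power_integral alpha (@annulus R n a b)).
have JE : power_integral alpha (@annulus R n a b) = J%:E.
  by rewrite fineK// ge0_fin_numE// power_integral_ge0.
have J0 : (0 <= J)%R by rewrite fine_ge0// power_integral_ge0.
have J1 : (0 < J + 1)%R by rewrite ltr_wpDl.
(* Half of e absorbs the error term, the other half the probability. *)
have e1 : (0 < e / 2 / (J + 1))%R by rewrite !divr_gt0.
have [k0 k00 H] := muC_compare n2 jd ah e1.
pose B j := @annulus R n 0 (b / j.+1%:R)%R.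
have mB j : measurable (B j) by exact: measurable_annulus.
have B0 : \bigcap_j B j = set0.
  rewrite -subset0 => x Bx; have [x0 _] := Bx 0%N I.
  have t0 := total_gt0 n2 x0.
  have [_ /andP[_]] := Bx (Num.truncn (b / total x)) I.
  by rewrite ltr_pdivlMr// mulrC -ltr_pdivlMr// ltNge ltW// truncnS_gt.
have niB : nonincreasing_seq B.
  move=> i j ij; apply/subsetPset => x [x0 /andP[x1 x2]]; split=> //.
  by rewrite x1 (lt_le_trans x2)// ler_pM2l// lef_pV2 ?posrE// ler_nat.
have muB : muC (B 0%N) < +oo.
  by rewrite (le_lt_trans (probability_le1 _ (mB 0%N)))// ltry.
have := nonincreasing_cvg_mu muB mB (bigcapT_measurable mB) niB.
rewrite B0 measure0 => cB.
have e2 : 0 < (e / 2)%:E by rewrite lte_fin divr_gt0.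
have : \forall j \near \oo, muC (B j) < (e / 2)%:E.
  exact: (cB _ (open_ereal_lt' e2)).
move=> [j0 _ hj0].
pose j := maxn j0 (Num.truncn (b / k0)).
pose k := (j.+1%:R^-1)%R : R.
have kpos : (0 < k)%R by rewrite invr_gt0.
have kb : (k * b < k0)%R.
  rewrite mulrC ltr_pdivrMr// mulrC -ltr_pdivrMr//.
  by rewrite (lt_le_trans (truncnS_gt _))// ler_nat ltnS leq_maxr.
have mA := @measurable_annulus R n a b.
have Ab : annulus a b `<=` @annulus R n 0 b.
  by move=> x [x0 /andP[ax xb]]; split=> //; rewrite xb (le_trans (ltW a0)).
have [+ _] := H _ _ _ kpos kb mA Ab.
move=> /le_trans; apply; rewrite JE.
rewrite [leRHS](_ : _ = (e / 2)%:E + (e / 2)%:E); last first.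
  by rewrite -EFinD -splitr.
apply: leeD; last first.
  rewrite -EFinM lee_fin; have : (0 <= e / 2)%R by rewrite divr_ge0 ?ltW.
  move: (e / 2)%R => y y0; rewrite -mulrA ler_piMr// ltW//.
  by rewrite mulrC ltr_pdivrMr// mul1r ltrDl.
rewrite (@le_trans _ _ (muC (dilate k (annulus a b))))//.
  rewrite gee_pMl// ?measure_ge0//.
  have k1 : (0 < k <= 1)%R by rewrite kpos /= invf_le1// ler1n.
  rewrite lee_fin (@le_trans _ _ (k `^ 0)%R)//; last by rewrite powRr0.
  by apply: ger_powR; rewrite ?oppr_ge0.
rewrite dilate_annulus//; apply: (@le_trans _ _ (muC (B j))).
  apply: le_measure; rewrite ?inE//; first exact: measurable_annulus.
  move=> x [x0 /andP[ax xb]]; split=> //; rewrite (mulrC b) xb andbT.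
  by rewrite (le_trans _ ax)// mulr_ge0// ltW.
by apply: ltW; apply: hj0; rewrite /= leq_maxl.
Qed.

(** Otherwise h would vanish almost everywhere on every annulus away from 0,
    hence on the orthant. *)
Lemma exponent_gt0 : (0 < n%:R + alpha)%R.
Proof.
rewrite ltNge; apply/negP => na.
have [_ _ + _ _] := ah; apply/negP; rewrite -leNgt.
pose E k := @annulus R n k.+1%:R^-1 k.+1%:R.
have mE k : measurable (E k) by exact: measurable_annulus.
have UE : (D : set V) = \bigcup_k E k.
  apply/seteqP; split=> [x x0|x [k _ []]//].
  have t0 := total_gt0 n2 x0.
  exists (maxn (Num.truncn (total x)) (Num.truncn (total x)^-1)) => //.
  split=> //.
  rewrite invf_ple ?posrE//; apply/andP; split.
    rewrite (le_trans (ltW (truncnS_gt _)))// ler_nat ltnS leq_maxr//.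
  rewrite (lt_le_trans (truncnS_gt _))// ler_nat ltnS leq_maxl//.
have ndE : nondecreasing_seq E.
  move=> i j ij; apply/subsetPset => x [x0 /andP[x1 x2]]; split=> //.
  rewrite (lt_le_trans x2) ?ler_nat//= andbT; apply: le_trans x1.
  by rewrite lef_pV2 ?posrE// ler_nat.
rewrite UE.
have := @ge0_nondecreasing_set_cvg_integral _ _ _ E
  (fun x : V => (h x)%:E) leb ndE mE
  (fun k => measurable_h ah (@annulus_orthant _ _ _ _) (mE k))
  (fun k x => @h_ge0 _ _ _ _ _ ah _ _ (@annulus_orthant _ _ _ _)).
apply: cvge_le; apply: nearW => k; apply: integral_annulus_le0 => //.
Qed.

Lemma integral_h_lty (S : R) : (0 < S)%R ->
  \int[leb]_(x in annulus 0 S) (h x)%:E < +oo.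
Proof.
move=> S0; have [k0 k00 H] := muC_compare n2 jd ah ltr01.
have k1 : (0 < k0 / 2 / S)%R by rewrite !divr_gt0.
have k2 : (k0 / 2 / S * S < k0)%R.
  by rewrite divfK ?gt_eqF// ltr_pdivrMr// ltr_pMr// ltr1n.
have mA := @measurable_annulus R n 0 S.
have [+ _] := H _ _ _ k1 k2 mA (@subset_refl _ _).
move=> /le_lt_trans; apply; apply: lte_add_pinfty.
  rewrite lte_mul_pinfty// ?lee_fin ?powR_ge0//.
  by rewrite (le_lt_trans (probability_le1 _ (measurable_dilate _ mA)))// ltry.
rewrite mul1e; apply: power_integral_ball => //; exact: exponent_gt0.
Qed.

Context (m : {measure set V -> \bar R}) (mh : has_density m h).

Lemma density_lty A (S : R) : (0 < S)%R -> measurable A ->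
  A `<=` annulus 0 S -> m A < +oo.
Proof.
move=> S0 mA AS; rewrite mh//; last by move=> x /AS[].
apply: le_lt_trans (integral_h_lty S0).
have mS := @measurable_annulus R n 0 S.
apply: ge0_subset_integral => //.
  exact: (measurable_h ah (@annulus_orthant _ _ _ _) mS).
by move=> x; exact: (h_ge0 ah (@annulus_orthant _ _ _ _)).
Qed.

(** Compact sets have bounded total mass, and h is integrable over the whole part
    of the orthant where the total mass is bounded. *)
Lemma density_radon : radon m.
Proof.
move=> K cK KD.
have [S S0 KS] : exists2 S : R, (0 < S)%R & K `<=` @annulus R n 0 S.
  have cT : compact (@total R n @` K).
    apply: continuous_compact => //; apply: continuous_subspaceT.
    exact: total_continuous.
  have [M [_ HM]] := compact_bounded cT.
  exists (`|M| + 2)%R; first by rewrite ltr_wpDl.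
  move=> x Kx; split; first exact: KD.
  rewrite ltW ?total_gt0//=; last exact: KD.
  have : (`|total x| <= `|M| + 1)%R.
    by apply: HM; [rewrite (le_lt_trans (ler_norm _))// ltrDl|exists x].
  by move=> /(le_trans (ler_norm _)) /le_lt_trans; apply; rewrite ltrD2l ltr1n.
have mK : measurable (K : set V).
  rewrite -(setCK K); apply: measurableC; apply: open_measurable_borel.
  by apply: closed_openC; apply: compact_closed => //; exact: norm_hausdorff.
exact: density_lty S0 mK KS.
Qed.

(** Chosen so that rate K ^ (- (n + alpha)) = K: dilating by it compensates the
    minimum over K copies. *)
Definition rate (K : nat) : R := (K%:R `^ (n%:R + alpha)^-1)^-1%R.

Lemma rate_gt0 K : (0 < K)%N -> (0 < rate K)%R.
Proof. by move=> K0; rewrite invr_gt0 powR_gt0// ltr0n. Qed.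

Lemma rate_power K : (0 < K)%N -> (rate K `^ (- (n%:R + alpha)) = K%:R)%R.
Proof.
move=> K0; rewrite /rate -powR_inv1 ?powR_ge0// -!powRrM.
have -> : ((n%:R + alpha)^-1 * (-1 * - (n%:R + alpha)) = 1 :> R)%R.
  by rewrite mulN1r opprK mulVf// gt_eqF// exponent_gt0.
by rewrite powRr1.
Qed.

(** The comparison [muC_compare] with an error weight small against the power
    integral of A, which is finite. *)
Lemma rescaled_cvg A (S e : R) : measurable A -> A `<=` annulus 0 S ->
  (0 < S)%R -> (0 < e)%R -> exists K0, forall K, (K0 <= K)%N -> (0 < K)%N ->
  m A <= K%:R%:E * muC (dilate (rate K) A) + e%:E /\
  K%:R%:E * muC (dilate (rate K) A) <= m A + e%:E.
Proof.
move=> mA AS S0 e0.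
have na := exponent_gt0.
have Joo : power_integral alpha A < +oo.
  apply: le_lt_trans (power_integral_ball n2 na S0).
  apply: ge0_subset_integral => //; first exact: measurable_annulus.
    by apply/measurable_EFinP; exact: measurable_power.
  by move=> x _; rewrite lee_fin powR_ge0.
pose J := fine (power_integral alpha A).
have JE : power_integral alpha A = J%:E.
  by rewrite fineK// ge0_fin_numE// power_integral_ge0.
have J0 : (0 <= J)%R by rewrite fine_ge0// power_integral_ge0.
have J1 : (0 < J + 1)%R by rewrite ltr_wpDl.
have e1 : (0 < e / (J + 1))%R by rewrite divr_gt0.
have eJ : (e / (J + 1))%:E * power_integral alpha A <= e%:E.
  rewrite JE -EFinM lee_fin -mulrA ler_piMr// ?ltW//.
  by rewrite mulrC ltr_pdivrMr// mul1r ltrDl.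
have [k0 k00 H] := muC_compare n2 jd ah e1.
have Sk : (0 < S / k0)%R by rewrite divr_gt0.
(* K > (S / k0) ^ (n + alpha) is rate K * S < k0, solved for K. *)
exists (Num.truncn ((S / k0) `^ (n%:R + alpha))%R).+1 => K hK K0.
have rS : (rate K * S < k0)%R.
  rewrite /rate mulrC ltr_pdivrMr ?powR_gt0 ?ltr0n// mulrC -ltr_pdivrMr//.
  have -> : (S / k0 = ((S / k0) `^ (n%:R + alpha)) `^ (n%:R + alpha)^-1)%R.
    by rewrite -powRrM mulfV ?powRr1// ?ltW// gt_eqF.
  apply: gt0_ltr_powR; rewrite ?invr_gt0 ?nnegrE ?powR_ge0//.
  by rewrite (lt_le_trans (truncnS_gt _))// ler_nat.
have AD : A `<=` D by move=> x /AS[].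
have := H _ _ _ (rate_gt0 K0) rS mA AS; rewrite rate_power// -mh//.
move=> [h1 h2]; split.
  by apply: (le_trans h1); rewrite leeD2l.
by apply: (le_trans h2); rewrite leeD2l.
Qed.

End rescaled_convergence.

(** * The limit law of rescaled minima *)

Section limits_of_powers.
Context (R : realType).
Implicit Types (x y : R).

Lemma bernoulli_inequality x k : 0 <= x <= 1 -> 1 - k%:R * x <= (1 - x) ^+ k.
Proof.
case/andP=> x0 x1; elim: k => [|k IH]; first by rewrite mul0r subr0.
rewrite exprS (le_trans _ (ler_wpM2l _ IH)) ?subr_ge0//.
have : 0 <= k%:R * (x * x) by rewrite !mulr_ge0.
by rewrite -natr1; lra.
Qed.

(** Squeeze (1 - y) ^ k between exp (- k y) (1 - k y ^ 2) and exp (- k y): the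
    lower bound is (1 - y) exp y >= 1 - y ^ 2 followed by the inequality of
    Bernoulli, and k y ^ 2 tends to 0 because k y stays bounded. *)
Lemma cvg_one_minus_exp (y : nat -> R) (c : R) : (forall k, 0 <= y k <= 1) ->
  k.+1%:R * y k @[k --> \oo] --> c ->
  (1 - y k) ^+ k.+1 @[k --> \oo] --> expR (- c).
Proof.
move=> y01 yc.
have cexp : expR (- (k.+1%:R * y k)) @[k --> \oo] --> expR (- c).
  apply: (@cvg_comp _ _ _ (fun k => - (k.+1%:R * y k)) expR _ (nbhs (- c))).
    exact: cvgN.
  exact: continuous_expR.
have csq : 1 - k.+1%:R * (y k * y k) @[k --> \oo] --> (1 : R).
  rewrite -[X in _ --> X]subr0; apply: cvgB; first exact: cvg_cst.
  rewrite (_ : (fun _ => _) =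
      (fun k => (k.+1%:R * y k) * (k.+1%:R * y k) * harmonic k)).
    by rewrite -(mulr0 (c * c)); apply: cvgM; [exact: cvgM|exact: cvg_harmonic].
  apply/funext => k; rewrite /harmonic /=.
  have : k.+1%:R != 0 :> R by rewrite pnatr_eq0.
  by move: (k.+1%:R) => z z0; field.
have clow : expR (- (k.+1%:R * y k)) * (1 - k.+1%:R * (y k * y k)) @[k --> \oo]
    --> expR (- c).
  by rewrite -[X in _ --> X]mulr1; exact: cvgM.
apply: squeeze_cvgr clow cexp.
apply: nearW => k; have /andP[y0 y1] := y01 k.
have eE : expR (- (k.+1%:R * y k)) = expR (- y k) ^+ k.+1.
  by rewrite -mulrN expRM_natl.
have up : 1 - y k <= expR (- y k) by exact: expR_ge1Dx.
have low : expR (- y k) * (1 - y k * y k) <= 1 - y k.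
  rewrite expRN mulrC ler_pdivrMr ?expR_gt0//.
  rewrite (_ : 1 - y k * y k = (1 - y k) * (1 + y k)); last by ring.
  by rewrite ler_wpM2l ?expR_ge1Dx// subr_ge0.
have yy : 0 <= y k * y k <= 1 by rewrite mulr_ge0//= mulr_ile1.
rewrite eE; apply/andP; split; last first.
  by rewrite lerXn2r ?nnegrE ?expR_ge0// subr_ge0.
apply: le_trans (_ : (expR (- y k) * (1 - y k * y k)) ^+ k.+1 <= _).
  rewrite exprMn ler_wpM2l ?exprn_ge0 ?expR_ge0//.
  exact: bernoulli_inequality.
by rewrite lerXn2r ?nnegrE// ?mulr_ge0 ?expR_ge0// subr_ge0//; case/andP: yy.
Qed.

End limits_of_powers.

Section portmanteau.
Context (R : realType) (T : ptopologicalType).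
Local Open Scope ereal_scope.

Lemma integral_between (nu : probability (borel T) R) (f : T -> R)
    (A B : set T) :
  measurable (A : set (borel T)) -> measurable (B : set (borel T)) ->
  continuous f -> (forall x, 0 <= f x <= 1)%R ->
  (forall x, A x -> f x = 1%R) -> (forall x, ~ B x -> f x = 0%R) ->
  nu A <= \int[nu]_x (f x)%:E <= nu B.
Proof.
move=> mA mB cf f01 fA fB.
have mf : measurable_fun setT (fun x : borel T => (f x)%:E).
  by apply/measurable_EFinP; exact: continuous_measurable_real.
have f0 (x : borel T) : 0 <= (f x)%:E by rewrite lee_fin; case/andP: (f01 x).
have mI (E : set (borel T)) : measurable E ->
    measurable_fun setT (fun x => (\1_E x : R)%:E).
  by move=> mE; apply/measurable_EFinP; exact: measurable_indic.
have iE (E : set (borel T)) : measurable E -> nu E = \int[nu]_x (\1_E x)%:E.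
  by move=> mE; rewrite integral_indic// setIT.
have i0 (E : set (borel T)) (x : borel T) : 0 <= (\1_E x : R)%:E.
  by rewrite lee_fin.
have Af (x : borel T) : (\1_A x : R)%:E <= (f x)%:E.
  rewrite lee_fin indicE.
  by have [/set_mem/fA ->|_] := boolP (x \in A); [|case/andP: (f01 x)].
have fB' (x : borel T) : (f x)%:E <= (\1_B x : R)%:E.
  rewrite lee_fin indicE.
  have [_|/negP xB] := boolP (x \in B); first by case/andP: (f01 x).
  by rewrite fB// => Bx; apply: xB; exact: mem_set.
rewrite (iE A mA) (iE B mB); apply/andP; split.
  apply: ge0_le_integral; first exact: measurableT.
  - exact (fun x _ => i0 A x).
  - exact (mI A mA).
  - exact mf.
  - exact (fun x _ => Af x).
apply: ge0_le_integral; first exact: measurableT.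
- exact (fun x _ => f0 x).
- exact mf.
- exact (mI B mB).
- exact (fun x _ => fB' x).
Qed.

(** A continuous f between the indicators of A and B transfers bounds on masses
    to the limit, whatever happens on the boundary of A. *)
Lemma weak_cvg_between (nu : nat -> probability (borel T) R)
    (mu : probability (borel T) R) (f : T -> R) (A B : set T) :
  weak_cvg (fun k => nu k) mu ->
  measurable (A : set (borel T)) -> measurable (B : set (borel T)) ->
  continuous f -> (forall x, 0 <= f x <= 1)%R ->
  (forall x, A x -> f x = 1%R) -> (forall x, ~ B x -> f x = 0%R) ->
  (forall l, nu k B @[k --> \oo] --> l -> mu A <= l) /\
  (forall l, nu k A @[k --> \oo] --> l -> l <= mu B).
Proof.
move=> wc mA mB cf f01 fA fB.
have bf : [bounded f x | x in [set: T]].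
  exists 1%R; split; first exact: num_real.
  move=> M M1 x _ /=; have /andP[f0 f1] := f01 x.
  by rewrite ger0_norm// (le_trans f1)// ltW.
have cI := wc f cf bf.
have H nu' := @integral_between nu' f A B mA mB cf f01 fA fB.
split=> l cl.
  have /andP[h1 _] := H mu; apply: (le_trans h1).
  by apply: (lee_cvg_to cI cl); apply: nearW => k; case/andP: (H (nu k)).
have /andP[_ h1] := H mu; apply: le_trans h1.
by apply: (lee_cvg_to cl cI); apply: nearW => k; case/andP: (H (nu k)).
Qed.

End portmanteau.

Section function_cylinders.
Context (R : realType) (n : nat).
Implicit Types (phi psi : Cspace R n) (s : seq (csimplex R n * R)).
Local Notation V := (borel 'rV[R]_n).

Lemma measurable_Some :
  measurable_fun setT (Some : borel (Cspace R n) -> Cbar R n).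
Proof.
apply: (@measurability _ _ _ (Cbar R n) _ _
  [set Some @` U | U in (@open (Cspace R n))]) => //.
move=> _ [_ [U oU <-] <-]; rewrite setTI; apply: sub_sigma_algebra.
rewrite (_ : _ @^-1` _ = U)//; apply/seteqP; split=> phi /=; last by exists phi.
by move=> [psi Upsi [<-]].
Qed.

Definition above_fun s : set (Cspace R n) :=
  [set phi | forall a, a \in s -> a.2 <= cfun phi a.1].

Lemma above_funE s : above_fun s = Some @^-1` above s.
Proof.
by apply/seteqP; split=> phi h a sa; have := h a sa; rewrite /= lee_fin.
Qed.

Lemma measurable_above_fun s : interior_nodes s ->
  measurable (above_fun s : set (borel (Cspace R n))).
Proof.
move=> os; rewrite above_funE -[X in measurable X]setTI.
apply: measurable_Some => //.
exact: measurable_above.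
Qed.

Definition lower (d : R) s := [seq (a.1, a.2 - d) | a <- s].

Definition rescale (k : R) s := [seq (a.1, k * a.2) | a <- s].

Lemma interior_lower d s : interior_nodes s -> interior_nodes (lower d s).
Proof. by move=> os _ /mapP[a sa ->]; exact: (os a sa). Qed.

Lemma interior_rescale k s : interior_nodes s -> interior_nodes (rescale k s).
Proof. by move=> os _ /mapP[a sa ->]; exact: (os a sa). Qed.

Lemma dilate_void_region k s : 0 < k ->
  dilate k (void_region s) = void_region (rescale k s).
Proof.
move=> k0; have kV : 0 < k^-1 by rewrite invr_gt0.
apply/seteqP; split=> x.
  move=> [a sa [x0 xa]]; exists (a.1, k * a.2); first by apply/mapP; exists a.
  split; first exact: (dilate_orthant k0 (@subset_refl _ (@orthant R n))).
  by move: xa; rewrite /= dotZr (mulrC k^-1) ltr_pdivrMr// (mulrC k).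
move=> [_ /mapP[a sa ->] [x0 xa]]; exists a => //; split.
  exact: orthant_scale.
by rewrite dotZr (mulrC k^-1) ltr_pdivrMr// (mulrC _ k).
Qed.

Lemma bigcup_void_region_lower s :
  \bigcup_k void_region (lower k.+1%:R^-1 s) = void_region s.
Proof.
apply/seteqP; split=> [x [k _ [_ /mapP[a sa ->] [x0 xa]]]|x [a sa [x0 xa]]].
  exists a => //; split=> //; apply: (lt_trans xa).
  by rewrite /= gtrBl invr_gt0.
have d0 : 0 < a.2 - dot (\val a.1) x by rewrite subr_gt0.
exists (Num.truncn (a.2 - dot (\val a.1) x)^-1) => //.
exists (a.1, a.2 - (Num.truncn (a.2 - dot (\val a.1) x)^-1).+1%:R^-1).
  by apply/mapP; exists a.
split=> //=; rewrite ltrBrDr -ltrBrDl invf_plt ?posrE//.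
exact: truncnS_gt.
Qed.

Lemma bigcap_above_lower s :
  \bigcap_k above_fun (lower k.+1%:R^-1 s) = above_fun s.
Proof.
apply/seteqP; split=> [phi h a sa|phi h k _ _ /mapP[a sa ->]]; last first.
  by rewrite /= lerBlDr (le_trans (h a sa))// lerDl.
rewrite leNgt; apply/negP => ha.
have d0 : 0 < a.2 - cfun phi a.1 by rewrite subr_gt0.
have := h (Num.truncn (a.2 - cfun phi a.1)^-1) I
  (a.1, a.2 - (Num.truncn (a.2 - cfun phi a.1)^-1).+1%:R^-1).
have -> : (a.1, a.2 - (Num.truncn (a.2 - cfun phi a.1)^-1).+1%:R^-1) \in
    lower (Num.truncn (a.2 - cfun phi a.1)^-1).+1%:R^-1 s.
  by apply/mapP; exists a.
move=> /(_ isT) /=; rewrite lerBlDr -lerBlDl leNgt invf_plt ?posrE//.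
by rewrite truncnS_gt.
Qed.

(** Equal to 1 when the constraints of s hold and to 0 when one of them fails by
    d or more. *)
Definition bump (d : R) s phi : R := \prod_(a <- s | a \in s)
  Num.max 0 (Num.min 1 (1 + (cfun phi a.1 - a.2) / d)).

Lemma bump_continuous d s : interior_nodes s -> continuous (bump d s).
Proof.
move=> os.
apply: (@continuous_big _ _ _ _ _ _ _ _ (fun a (phi : Cspace R n) =>
  Num.max 0 (Num.min 1 (1 + (cfun phi a.1 - a.2) / d)))).
  exact: mul_continuous.
move=> a sa phi; have ce := @eval_continuous R n _ (os _ sa) phi.
have clip_cont :
    continuous (fun y : R => Num.max 0 (Num.min 1 (1 + (y - a.2) / d))).
  move=> y; have affine : {for y, continuous (fun y : R => 1 + (y - a.2) / d)}.
    apply: cvgD; first exact: cvg_cst.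
    apply: cvgM; last exact: cvg_cst.
    by apply: cvgB; [exact: cvg_id|exact: cvg_cst].
  apply: (@continuous_max _ _ (fun=> 0)
    (fun y => Num.min 1 (1 + (y - a.2) / d))).
    exact: cst_continuous.
  by apply: (@continuous_min _ _ (fun=> 1)); [exact: cst_continuous|].
exact: (@continuous_comp (Cspace R n) R R (fun phi => cfun phi a.1) _ phi ce
  (@clip_cont _)).
Qed.

Lemma bump01 d s phi : 0 <= bump d s phi <= 1.
Proof.
apply: (big_ind (fun x => 0 <= x <= 1)) => [|x y /andP[x0 x1] /andP[y0 y1]|a _].
- by rewrite ler01 lexx.
- by rewrite mulr_ge0//= mulr_ile1.
- by rewrite le_max lexx/= ge_max ler01/= ge_min lexx.
Qed.

Lemma bump1 d s phi : 0 < d -> above_fun s phi -> bump d s phi = 1.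
Proof.
move=> d0 h; rewrite /bump; apply: big1 => a sa.
have h1 : 1 <= 1 + (cfun phi a.1 - a.2) / d.
  by rewrite lerDl divr_ge0 ?subr_ge0 ?h// ltW.
by rewrite (min_idPl h1); apply/max_idPr.
Qed.

Lemma bump0 d s phi : 0 < d -> ~ above_fun (lower d s) phi -> bump d s phi = 0.
Proof.
move=> d0 h; apply: contrapT => b0; apply: h => _ /mapP[a sa ->] /=.
rewrite leNgt; apply/negP => ha; apply: b0.
rewrite /bump -big_seq (big_rem a)//=.
have h1 : 1 + (cfun phi a.1 - a.2) / d <= 0.
  rewrite -(@ler_pM2r _ d)// mul0r mulrDl divfK ?gt_eqF// mul1r.
  by move: ha; lra.
have -> : Num.min 1 (1 + (cfun phi a.1 - a.2) / d) =
    1 + (cfun phi a.1 - a.2) / d.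
  by apply/min_idPr; rewrite (le_trans h1).
by rewrite (max_idPl h1) mul0r.
Qed.

End function_cylinders.

Section limit_law.
Context (R : realType) (n : nat) (n2 : (2 <= n)%N).
Context (d1 : measure_display) (Omega1 : measurableType d1).
Context (P1 : probability Omega1 R) (C : {mfun Omega1 >-> borel 'rV[R]_n}).
Context (rho : 'rV[R]_n -> R) (alpha : R) (h : 'rV[R]_n -> R).
Context (d2 : measure_display) (Omega2 : measurableType d2).
Context (P2 : probability Omega2 R).
Context (ell : {mfun Omega1 >-> borel (Cspace R n)}).
Context (ells : nat -> {mfun Omega2 >-> borel (Cspace R n)}).
Context (X : nat -> {mfun Omega2 >-> borel (Cspace R n)}).
Context (mu : probability (borel (Cspace R n)) R).
Context (m : {measure set (borel 'rV[R]_n) -> \bar R}).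
Context (Cpos : forall w, orthant (C w)).
Context (jd : joint_density (distribution P1 C) rho).
Context (ah : asymptotically_homogeneous rho alpha h).
Context (ellE : forall w p, cfun (ell w) p = dot (C w) (\val p)).
Context (ind : independent_copies P1 ell P2 ells).
Context (XE : forall K : nat, (0 < K)%N -> forall w p, cfun (X K w) p =
  K%:R `^ (n%:R + alpha)^-1 *
  \big[Num.min/cfun (ells 0%N w) p]_(k < K) cfun (ells k w) p).
Context (wc : weak_cvg (fun K => distribution P2 (X K)) mu).
Context (mh : has_density m h).
Implicit Types (s : seq (csimplex R n * R)).
Local Open Scope ereal_scope.
Local Notation muC := (distribution P1 C).
Local Notation rate := (rate n alpha).

Lemma ell_above k s : interior_nodes s -> (0 < k)%R ->
  P1 (ell @^-1` above_fun (rescale k s)) = 1 - muC (dilate k (void_region s)).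
Proof.
move=> os k0; rewrite /distribution /pushforward -probability_setC; last first.
  rewrite -[X in measurable X]setTI; apply: measurable_funP => //.
  by apply: measurable_dilate; exact: measurable_void_region.
congr (P1 _); rewrite dilate_void_region//; apply/seteqP; split=> w /=.
  move=> hw [a sa [_ Ca]]; have := hw a sa; rewrite ellE dotC.
  by rewrite leNgt Ca.
move=> hw a sa; rewrite ellE dotC leNgt; apply/negP => Ca; apply: hw.
by exists a.
Qed.

(** Dividing by K ^ (1 / (n + alpha)) rescales the levels, and a minimum lies
    above a level exactly when each term does. *)
Lemma rescaled_min_above K s : (0 < K)%N ->
  X K @^-1` above_fun s =
  \bigcap_(k in [set: 'I_K]) (ells k @^-1` above_fun (rescale (rate K) s)).
Proof.
move=> K0; have c0 : (0 < K%:R `^ (n%:R + alpha)^-1 :> R)%R.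
  by rewrite powR_gt0// ltr0n.
apply/seteqP; split=> w hw.
  move=> k _ _ /mapP[a sa ->] /=; rewrite mulrC ler_pdivrMr//.
  apply: le_trans (hw a sa) _; rewrite XE// mulrC ler_pM2r//.
  exact: bigmin_le_cond.
move=> a sa; rewrite XE// mulrC -ler_pdivrMr//.
have H (k : 'I_K) : (a.2 / K%:R `^ (n%:R + alpha)^-1 <= cfun (ells k w) a.1)%R.
  rewrite mulrC; apply: (hw k I (a.1, _)).
  by apply/mapP; exists a.
by apply/bigmin_geP; split=> [|k _]; [exact: (H (Ordinal K0))|exact: H].
Qed.

Definition hit_prob K s :=
  fine (muC (dilate (rate K.+1) (void_region s))).

Lemma hit_probE K s :
  muC (dilate (rate K.+1) (void_region s)) = (hit_prob K s)%:E.
Proof.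
rewrite /hit_prob fineK//; apply: fin_num_measure; apply: measurable_dilate.
exact: measurable_void_region.
Qed.

Lemma law_above K s : interior_nodes s ->
  distribution P2 (X K.+1) (above_fun s) = ((1 - hit_prob K s) ^+ K.+1)%:E.
Proof.
move=> os; rewrite /distribution {1}/pushforward rescaled_min_above//.
have [indep copy] := ind; set A := above_fun _.
have mA : measurable (A : set (borel (Cspace R n))).
  by apply: measurable_above_fun; exact: interior_rescale.
rewrite (indep K.+1 (fun=> A))//.
have E (k : 'I_K.+1) : P2 (ells k @^-1` A) = (1 - hit_prob K s)%:E.
  rewrite EFinB -hit_probE -ell_above//; last exact: rate_gt0.
  exact: copy.
rewrite (eq_bigr (fun=> (1 - hit_prob K s)%:E)) => [|k _]; last exact: E.
by rewrite prodEFin prodr_const card_ord.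
Qed.

Lemma law_above_cvg s : interior_nodes s ->
  distribution P2 (X K.+1) (above_fun s) @[K --> \oo] -->
    expeR (- m (void_region s)).
Proof.
move=> os; have [S S0 hS] := void_region_bounded os.
have RS : void_region s `<=` annulus 0 S.
  move=> x sx; have x0 := void_region_orthant sx; split=> //.
  by rewrite (hS _ sx) andbT ltW// total_gt0.
have mR := measurable_void_region s.
have mfin := density_lty n2 jd ah mh S0 mR RS.
pose c := fine (m (void_region s)).
have cE : m (void_region s) = c%:E by rewrite fineK// ge0_fin_numE.
have hit01 K : (0 <= hit_prob K s <= 1)%R.
  rewrite -!lee_fin -hit_probE measure_ge0/= probability_le1//.
  exact: measurable_dilate.
have hitc : (K.+1%:R * hit_prob K s)%R @[K --> \oo] --> c.
  apply/cvgrPdist_le => e e0.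
  have [K0 H] := rescaled_cvg n2 jd ah mh mR RS S0 e0.
  exists K0 => // K /= hK.
  have : c%:E <= K.+1%:R%:E * (hit_prob K s)%:E + e%:E /\
      K.+1%:R%:E * (hit_prob K s)%:E <= c%:E + e%:E.
    by rewrite -hit_probE -cE; exact: H (leq_trans hK (leqnSn K)) isT.
  rewrite -!EFinM -!EFinD !lee_fin => -[h1 h2].
  by rewrite ler_distl; lra.
have := cvg_one_minus_exp hit01 hitc.
rewrite cE /= => cp; under eq_fun do rewrite law_above//.
by apply: cvg_EFin; [exact: nearW|exact: cp].
Qed.

(** The upper bound uses that the regions of the lowered constraints increase to
    the region of s (the half-spaces are open), the lower bound that the
    lowered cylinders decrease to that of s (they are closed).  The one-sided
    bounds meet at exp (- m U_s). *)
Lemma limit_above s : interior_nodes s ->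
  mu (above_fun s) = expeR (- m (void_region s)).
Proof.
move=> os; have d0 k : (0 < k.+1%:R^-1 :> R)%R by rewrite invr_gt0.
have wc1 : weak_cvg (fun K => distribution P2 (X K.+1)) mu.
  by move=> f cf bf; have := wc cf bf; rewrite -cvg_shiftS.
have mA t : interior_nodes t ->
    measurable (above_fun t : set (borel (Cspace R n))).
  exact: measurable_above_fun.
have os' k : interior_nodes (lower k.+1%:R^-1 s) by exact: interior_lower.
have between k := @weak_cvg_between _ _
  (fun K => distribution P2 (X K.+1) : probability _ _) mu _ _ _ wc1
  (mA _ os) (mA _ (os' k))
  (@bump_continuous _ _ (k.+1%:R^-1)%R _ os) (@bump01 _ _ _ _)
  (fun phi => bump1 (d0 k)) (fun phi => bump0 (d0 k)).
have mL k := mA _ (os' k).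
have up k : mu (above_fun s) <= expeR (- m (void_region (lower k.+1%:R^-1 s))).
  by have [+ _] := between k; apply; exact: law_above_cvg.
have lo k : expeR (- m (void_region s)) <= mu (above_fun (lower k.+1%:R^-1 s)).
  by have [_] := between k; apply; exact: law_above_cvg.
have lowS k l : (k <= l)%N -> (l.+1%:R^-1 <= k.+1%:R^-1 :> R)%R.
  by move=> kl; rewrite lef_pV2 ?posrE// ler_nat.
apply/eqP; rewrite eq_le; apply/andP; split.
  rewrite -(bigcup_void_region_lower s); apply: le_expeRN => //.
  - by move=> k; exact: measurable_void_region.
  - move=> k l kl; apply/subsetPset => x [_ /mapP[a sa ->] [x0 xa]].
    exists (a.1, a.2 - l.+1%:R^-1)%R; first by apply/mapP; exists a.
    by split=> //; rewrite (lt_le_trans xa)// lerD2l lerN2 lowS.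
rewrite -(bigcap_above_lower s).
have mu0 : mu (above_fun (lower 1%:R^-1 s)) < +oo.
  by rewrite (le_lt_trans (probability_le1 _ (mL 0%N)))// ltry.
have ni : nonincreasing_seq (fun k => above_fun (lower k.+1%:R^-1 s)).
  move=> k l kl; apply/subsetPset => phi hphi _ /mapP[a sa ->].
  have := hphi (a.1, a.2 - l.+1%:R^-1)%R; rewrite /= => hp.
  apply: (@le_trans _ _ (a.2 - l.+1%:R^-1)%R).
    by rewrite lerD2l lerN2 lowS.
  by apply: hp; apply/mapP; exists a.
apply: cvge_ge (nonincreasing_cvg_mu mu0 mL (bigcapT_measurable mL) ni).
by apply: nearW => k; exact: lo.
Qed.

Lemma limit_void_law :
  void_law (pushforward mu (Some : borel (Cspace R n) -> Cbar R n)) m.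
Proof. by move=> s os; rewrite /pushforward -above_funE; exact: limit_above. Qed.

End limit_law.

(** * Tail functional of Poisson infima *)

Theorem theorem3p14 (R : realType) (n : nat) (hn : (2 <= n)%N) :
  (forall (d : measure_display) (Omega : measurableType d)
      (P : probability Omega R)
      (m : {measure set (borel 'rV[R]_n) -> \bar R})
      (N : Omega -> set 'rV[R]_n),
    radon m -> poisson_process P m N ->
    measurable_fun setT (fun w => Psi (N w)) /\
    forall psi : Cspace R n,
      tail (pushforward P (fun w => Psi (N w))) psi =
        P [set w | infimum_ge (N w) psi] /\
      P [set w | infimum_ge (N w) psi] =
        expeR (- m (Rhat psi))) /\
  (forall (d1 : measure_display) (Omega1 : measurableType d1)
      (P1 : probability Omega1 R) (C : {mfun Omega1 >-> borel 'rV[R]_n})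
      (rho : 'rV[R]_n -> R) (alpha : R) (h : 'rV[R]_n -> R)
      (d2 : measure_display) (Omega2 : measurableType d2)
      (P2 : probability Omega2 R)
      (ell : {mfun Omega1 >-> borel (Cspace R n)})
      (ells : nat -> {mfun Omega2 >-> borel (Cspace R n)})
      (X : nat -> {mfun Omega2 >-> borel (Cspace R n)})
      (mu : probability (borel (Cspace R n)) R)
      (m : {measure set (borel 'rV[R]_n) -> \bar R}),
    (forall w, orthant (C w)) ->
    joint_density (distribution P1 C) rho ->
    asymptotically_homogeneous rho alpha h ->
    (forall w p, cfun (ell w) p = dot (C w) (\val p)) ->
    independent_copies P1 ell P2 ells ->
    (forall K : nat, (0 < K)%N -> forall w p, cfun (X K w) p =
       K%:R `^ (n%:R + alpha)^-1 *
       \big[Num.min/cfun (ells 0%N w) p]_(k < K) cfun (ells k w) p) ->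
    weak_cvg (fun K => distribution P2 (X K)) mu ->
    has_density m h ->
    [/\ radon m,
        forall psi : Cspace R n,
          tail (pushforward mu (Some : borel (Cspace R n) -> Cbar R n)) psi =
            expeR (- m (Rhat psi)) &
        forall (d : measure_display) (Omega : measurableType d)
            (P : probability Omega R) (N : Omega -> set 'rV[R]_n),
          poisson_process P m N ->
          forall B : set (Cbar R n), measurable B ->
            pushforward mu (Some : borel (Cspace R n) -> Cbar R n) B =
              pushforward P (fun w => Psi (N w)) B]).
Proof.
split.
  move=> d Omega P m N _ PN; split; first exact: measurable_Psi PN.
  move=> psi; split; last exact: poisson_tail PN psi.
  by rewrite (infimum_ge_Psi PN).
move=> d1 Omega1 P1 C rho alpha h d2 Omega2 P2 ell ells X mu m Cpos jd ah ellE
  ind XE wc mh.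
have muV := limit_void_law hn Cpos jd ah ellE ind XE wc mh.
pose nu := image_measure mu (@measurable_Some R n).
have nuV : void_law nu m by [].
split; first exact: (density_radon hn jd ah mh).
  by move=> psi; exact: (void_law_tail hn (Q := nu)).
move=> d Omega P N PN B mB.
exact: (void_law_unique hn (Q1 := nu)
  (Q2 := image_measure P (measurable_Psi hn PN)) nuV (poisson_void_law PN) mB).
Qed.
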